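(* Let $u_1,\dots,u_m$ be unit vectors in $\mathbb R^n$ such that there are positive numbers $c_1,\dots,c_m$ satisfying $$\sum_{j=1}^m c_j\,u_j\otimes u_j=\mathrm{Id}_{\mathbb R^n}.$$ For any $m$ continuous bounded functions $V_1,\dots,V_m$ on $\mathbb R$, define on $\mathbb R^n$ $$V(x)=\sum_{j=1}^m V_j(u_j\cdot x).$$ Then $$\lambda(V)\le\sum_{j=1}^m c_j\,\lambda\left(\frac1{c_j}V_j\right).$$
   Context: $u\otimes u$ denotes the operator $x\mapsto(u\cdot x)u$. For a continuous bounded function $W$ on $\mathbb R^d$ (used with $d=n$ for $V$ and with $d=1$ for the functions $\frac1{c_j}V_j$), define $$\lambda(W)=\sup\left\{\int_{\mathbb R^d}W(x)\phi^2(x)\,dx-4\int_{\mathbb R^d}|\nabla\phi(x)|^2\,dx\ :\ \int_{\mathbb R^d}\phi^2(x)\,dx=1\right\},$$ the supremum being over $\phi$ in the Sobolev space $H^1(\mathbb R^d)$; so $-\lambda(W)$ is the bottom of the spectrum of $-4\Delta-W$. *)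

(* Defs.v *)
From HB Require Import structures.
From mathcomp Require Import all_boot all_order all_algebra.
From mathcomp Require Import all_classical all_reals all_analysis.

Set Implicit Arguments.
Unset Strict Implicit.
Unset Printing Implicit Defensive.

Import Order.TTheory GRing.Theory Num.Theory.
Import numFieldNormedType.Exports.

Local Open Scope classical_set_scope.
Local Open Scope ring_scope.

(* R^n is 'rV[R]_n with the library's topology.  The library's norm on
   'rV[R]_n is the sup norm, so Euclidean lengths go through dotp. *)
Definition dotp (R : realType) (n : nat) (x y : 'rV[R]_n) : R :=
  \sum_(i < n) x ord0 i * y ord0 i.

Definition tensor (R : realType) (n : nat) (u : 'rV[R]_n) :
  'rV[R]_n -> 'rV[R]_n := fun x => dotp u x *: u.

(* The sigma-algebra on R^n generated by the coordinates (the product, hence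
   Borel, sigma-algebra), as the library does for n.-tuple. *)
Definition rV_display : measure_display.
Proof. exact: default_measure_display. Qed.

Section measurable_rV.
Variables (R : realType) (n : nat).

Definition rV_coord (i : 'I_n) (x : 'rV[R]_n) : measurableTypeR R := x ord0 i.

Definition rV_measurable : set (set 'rV[R]_n) := g_sigma_preimage rV_coord.

Let rV_set0 : rV_measurable set0.
Proof. exact: sigma_algebra0. Qed.

Let rV_setC A : rV_measurable A -> rV_measurable (~` A).
Proof. exact: sigma_algebraC. Qed.

Let rV_bigcup (F : (set 'rV[R]_n)^nat) :
  (forall i, rV_measurable (F i)) -> rV_measurable (\bigcup_i F i).
Proof. exact: sigma_algebra_bigcup. Qed.

HB.instance Definition _ := @isMeasurable.Build rV_display
  'rV[R]_n rV_measurable rV_set0 rV_setC rV_bigcup.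

End measurable_rV.

Section measurable_fun_rV.
Context d (T : measurableType d) (R : realType).

Lemma measurable_rV_coord n (i : 'I_n) :
  measurable_fun [set: 'rV[R]_n] (@rV_coord R n i).
Proof.
move=> _ Y mY; rewrite setTI; apply: sub_sigma_algebra => /=.
rewrite -bigcup_seq/=; exists i => /=; first by rewrite mem_index_enum.
by exists Y => //; rewrite setTI.
Qed.

Lemma measurable_fun_rV n (f : T -> 'rV[R]_n) :
  (forall i, measurable_fun setT (@rV_coord R n i \o f)) ->
  measurable_fun setT f.
Proof.
move=> mf.
have prefS : g_sigma_preimage (fun i => @rV_coord R n i \o f) `<=` measurable.
  apply: smallest_sub; first exact: sigma_algebra_measurable.
  rewrite -bigcup_seq => A [i _] [B mB <-].
  by apply: mf.
rewrite g_sigma_preimage_comp in prefS.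
by move=> _ A mA; apply: prefS; exists A.
Qed.

End measurable_fun_rV.

Section lebesgue_rV.
Variable R : realType.

Definition cons_rV n (p : measurableTypeR R * 'rV[R]_n) : 'rV[R]_n.+1 :=
  row_mx (p.1)%:M p.2.

Lemma cons_rV0 n (p : measurableTypeR R * 'rV[R]_n) :
  cons_rV p ord0 ord0 = p.1 :> R.
Proof.
have -> : (ord0 : 'I_n.+1) = lshift n (ord0 : 'I_1) by exact: val_inj.
by rewrite /cons_rV (@row_mxEl _ 1 1 n) mxE eqxx mulr1n.
Qed.

Lemma cons_rVS n (p : measurableTypeR R * 'rV[R]_n) (i : 'I_n) :
  cons_rV p ord0 (lift ord0 i) = p.2 ord0 i.
Proof.
have -> : lift ord0 i = rshift 1 i by exact: val_inj.
by rewrite /cons_rV (@row_mxEr _ 1 1 n).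
Qed.

Lemma measurable_cons_rV n : measurable_fun setT (@cons_rV n).
Proof.
apply: measurable_fun_rV => i.
case: (unliftP ord0 i) => [j ->|->].
  rewrite (_ : _ \o _ = @rV_coord R n j \o snd); last first.
    by apply/funext => p /=; rewrite /rV_coord cons_rVS.
  by apply: measurableT_comp => //; exact: measurable_rV_coord.
rewrite (_ : _ \o _ = fst) //.
by apply/funext => p /=; rewrite /rV_coord cons_rV0.
Qed.

Lemma measurable_behead_rV n :
  measurable_fun setT (fun x : 'rV[R]_n.+1 => (rsubmx (x : 'rV[R]_(1 + n)))).
Proof.
apply: measurable_fun_rV => i.
rewrite (_ : _ \o _ = @rV_coord R n.+1 (lift ord0 i)).
  exact: measurable_rV_coord.
apply/funext => x; rewrite /rV_coord /= mxE; congr (x _ _).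
exact: val_inj.
Qed.

Section step.
Variables (n : nat) (mu : {sigma_finite_measure set 'rV[R]_n -> \bar R}).

Definition lebesgue_rV_step : set 'rV[R]_n.+1 -> \bar R :=
  pushforward (lebesgue_measure \x mu)%E (@cons_rV n).

Let nu : {measure set 'rV[R]_n.+1 -> \bar R} :=
  measure_function_pushforward__canonical__measure_function_Measure
    (lebesgue_measure \x mu)%E (@measurable_cons_rV n).

HB.instance Definition _ := isMeasure.Build _ _ _ lebesgue_rV_step
  (measure0 nu) (measure_ge0 nu) (@measure_semi_sigma_additive _ _ _ nu).

Let sigma_finite_step : sigma_finite setT lebesgue_rV_step.
Proof.
have /sigma_finiteP[F [TF ndF Foo]] := sigma_finiteT (@lebesgue_measure R).
have /sigma_finiteP[G [TG ndG Goo]] := sigma_finiteT mu.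
pose hd (x : 'rV[R]_n.+1) : measurableTypeR R := x ord0 ord0.
pose tl (x : 'rV[R]_n.+1) := rsubmx (x : 'rV[R]_(1 + n)).
exists (fun k => hd @^-1` F k `&` tl @^-1` G k).
  apply/esym; rewrite -subTset => x _.
  have [i _ Fi] : (\bigcup_i F i) (hd x) by rewrite -TF.
  have [j _ Gj] : (\bigcup_i G i) (tl x) by rewrite -TG.
  exists (maxn i j) => //; split => /=.
    by move: (hd x) Fi; exact/subsetPset/ndF/leq_maxl.
  by move: (tl x) Gj; exact/subsetPset/ndG/leq_maxr.
move=> k; have [mF Fk] := Foo k; have [mG Gk] := Goo k; split.
  apply: measurableI.
    by rewrite -[X in measurable X]setTI; exact: (@measurable_rV_coord R n.+1).
  by rewrite -[X in measurable X]setTI; exact: measurable_behead_rV.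
rewrite /lebesgue_rV_step /pushforward.
rewrite (_ : _ @^-1` _ = F k `*` G k); last first.
  apply/seteqP; split=> -[a v] /=;
    by rewrite /hd /tl cons_rV0 /cons_rV row_mxKr.
by rewrite product_measure1E// lte_mul_pinfty// ge0_fin_numE.
Qed.

HB.instance Definition _ :=
  Measure_isSigmaFinite.Build _ _ _ lebesgue_rV_step sigma_finite_step.

End step.

Fixpoint lebesgue_rV (n : nat) :
    {sigma_finite_measure set 'rV[R]_n -> \bar R} :=
  match n with
  | 0 => \d_ (0 : 'rV[R]_0)
  | k.+1 => lebesgue_rV_step (lebesgue_rV k)
  end.

Lemma lebesgue_rV_box n (A : 'I_n -> set (measurableTypeR R)) :
  (forall i, measurable (A i)) ->
  lebesgue_rV n [set x | forall i, A i (x ord0 i)] =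
  (\prod_(i < n) lebesgue_measure (A i))%E.
Proof.
elim: n A => [|n IHn] A mA.
  rewrite big_ord0 /= diracE mem_set//.
  by move=> [].
pose B := [set x : 'rV[R]_n | forall i, A (lift ord0 i) (x ord0 i)].
have mB : measurable B.
  rewrite (_ : B = \big[setI/setT]_(i < n) (@rV_coord R n i @^-1`
                                              A (lift ord0 i))).
    apply: bigsetI_measurable => i _.
    by rewrite -[X in measurable X]setTI; exact: measurable_rV_coord.
  rewrite -bigcap_seq; apply/seteqP; split => x /=.
    by move=> xA i _; exact: xA.
  by move=> xA i; apply: xA => /=; rewrite mem_index_enum.
rewrite big_ord_recl /= -(IHn (fun i => A (lift ord0 i)))//.
rewrite -[X in (_ * lebesgue_rV n X)%E]/B -product_measure1E//.
rewrite /lebesgue_rV_step /pushforward; congr (product_measure1 _ _ _).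
apply/seteqP; split => [[a v]|[a v]] /=.
  move=> av; split; first by have := av ord0; rewrite cons_rV0.
  by move=> i; have := av (lift ord0 i); rewrite cons_rVS.
move=> [Aa Av] i; case: (unliftP ord0 i) => [j ->|->].
  by rewrite cons_rVS; exact: Av.
by rewrite cons_rV0.
Qed.

End lebesgue_rV.

Section sobolev.
Variables (R : realType) (d : nat).
Implicit Types (phi psi g : 'rV[R]_d -> R) (G : 'rV[R]_d -> 'rV[R]_d).

Let mu := lebesgue_rV R d.

Definition partial (i : 'I_d) (f : 'rV[R]_d -> R) : 'rV[R]_d -> R :=
  fun x => 'D_(delta_mx ord0 i) f x.

Definition iter_partial (s : seq 'I_d) (f : 'rV[R]_d -> R) : 'rV[R]_d -> R :=
  foldr partial f s.

Definition smooth (f : 'rV[R]_d -> R) : Prop :=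
  forall s : seq 'I_d, continuous (iter_partial s f) /\
    forall i x, derivable (iter_partial s f) x (delta_mx ord0 i).

Definition test_function psi : Prop :=
  smooth psi /\ compact (closure [set x | psi x != 0]).

Definition weak_partial (i : 'I_d) phi g : Prop :=
  forall psi, test_function psi ->
    (\int[mu]_x (phi x * partial i psi x)%:E
     = - \int[mu]_x (g x * psi x)%:E)%E.

(* phi is (a representative of) an element of H^1(R^d) and G is (a
   representative of) its weak gradient. *)
Definition H1_grad phi G : Prop :=
  phi \in Lfun mu 2%:E /\
  forall i : 'I_d, (fun x => G x ord0 i) \in Lfun mu 2%:E /\
    weak_partial i phi (fun x => G x ord0 i).

Definition lambda (W : 'rV[R]_d -> R) : \bar R :=
  ereal_sup [set e | exists phi G, [/\ H1_grad phi G,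
    (\int[mu]_x (phi x ^+ 2)%:E = 1)%E &
    e = (\int[mu]_x (W x * phi x ^+ 2)%:E
         - 4%:E * \int[mu]_x (dotp (G x) (G x))%:E)%E]].

End sobolev.

(* Main.v *)
(* The inequality reduces to a single direction [u]: the decomposition of the
   identity gives |grad phi|^2 = \sum_j c_j (u_j . grad phi)^2, so it suffices
   to bound, for each j,
     \int V_j (u_j . x) phi^2 - 4 c_j \int (u_j . grad phi)^2
   by c_j lambda (V_j / c_j) \int phi^2.  Almost every restriction of phi to a
   line of direction u is in H^1(R) with weak derivative the restriction of
   u . grad phi, so the one-dimensional inequality applies to it, and
   integrating over the lines concludes.
   To see that the restrictions are in H^1(R), test the weak derivative against
   translates of a test function: for fixed a < t this gives
     phi (x + t u) - phi (x + a u) = \int_a^t (u . grad phi) (x + r u) dr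
   for almost every x, and Fubini exchanges the quantifiers over x and t. *)

Require Import Defs.
From mathcomp Require Import all_boot all_order all_algebra.
From mathcomp Require Import all_classical all_reals all_analysis.
From mathcomp Require Import ring lra measurable_realfun.
Import Order.TTheory GRing.Theory Num.Theory.
Import numFieldNormedType.Exports.
Local Open Scope classical_set_scope.
Local Open Scope ring_scope.
Set Implicit Arguments.
Unset Strict Implicit.
Unset Printing Implicit Defensive.

(** * Lebesgue measure on 'rV[R]_n *)

(** The definition of the weak derivative cannot be sliced directly: each test function would bring
    its own null set of lines, and there are uncountably many. The formula for increments has only
    the parameters a and t: a is restricted to the integers -k, which costs countably many null
    sets, and t is left to Fubini. Two classes of test functions enclose the smooth ones. On R^n the
    weak derivative is used only against sums and products of functions built from exp(-1/t), which
    approximate indicators of boxes; on the line it is established against all compactly supported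
    C^1 functions. Translations are the only changes of variables in R^n: lines are indexed by base
    points x in R^n, and the slab 0 <= u.x <= 1 gives each line total weight 1. Adding a constant K
    to V_j makes both sides of the one-dimensional inequality nonnegative, so that Tonelli applies
    over the lines; the added terms cancel at the end. That inequality is stated with a real bound L
    of lambda, the infinite values being treated separately. *)

Lemma lebesgue_measure_itvoo (R : realType) (a b : R) :
  lebesgue_measure (`]a, b[%classic : set (measurableTypeR R)) =
  (Num.max 0 (b - a))%:E.
Proof.
rewrite lebesgue_measure_itv /= lte_fin; case: ltP => ab.
  by rewrite -EFinB; congr EFin; apply/esym/max_idPr; rewrite subr_ge0 ltW.
by congr EFin; apply/esym/max_idPl; rewrite subr_le0.
Qed.

Definition open_box (R : realType) (n : nat) (a b : 'I_n -> R) : set 'rV[R]_n :=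
  [set x | forall i, a i < x ord0 i < b i].

Lemma open_boxE (R : realType) (n : nat) (a b : 'I_n -> R) :
  open_box a b = [set x | forall i, `]a i, b i[%classic (x ord0 i)].
Proof.
by apply/seteqP; split => x /= + i => /(_ i); rewrite in_itv.
Qed.

Lemma lebesgue_rV_open_box (R : realType) (n : nat) (a b : 'I_n -> R) :
  lebesgue_rV R n (open_box a b) = (\prod_(i < n) (Num.max 0 (b i - a i))%:E)%E.
Proof.
rewrite open_boxE (@lebesgue_rV_box R n (fun i => `]a i, b i[%classic))//.
by apply: eq_bigr => i _; rewrite lebesgue_measure_itvoo.
Qed.

Lemma lebesgue_rV_open_box_lty (R : realType) (n : nat) (a b : 'I_n -> R) :
  (lebesgue_rV R n (open_box a b) < +oo)%E.
Proof. by rewrite lebesgue_rV_open_box prodEFin ltry. Qed.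

Lemma measurable_open_box (R : realType) (n : nat) (a b : 'I_n -> R) :
  measurable (open_box a b).
Proof.
have -> : open_box a b = \bigcap_(i in [set: 'I_n])
    (@rV_coord R n i @^-1` `]a i, b i[%classic).
  rewrite open_boxE; apply/seteqP; split => x /= H i; [move=> _|]; exact: H.
apply: fin_bigcap_measurable => // i _.
by rewrite -[X in measurable X]setTI; exact: measurable_rV_coord.
Qed.

Definition open_boxes (R : realType) (n : nat) : set (set 'rV[R]_n) :=
  [set B | exists a b, B = open_box a b].

Definition cube (R : realType) (n k : nat) : set 'rV[R]_n :=
  open_box (fun=> - k%:R) (fun=> k%:R).

Lemma bigcup_cube (R : realType) (n : nat) : \bigcup_k @cube R n k = setT.
Proof.
rewrite -subTset => x _ /=.
exists (Num.Def.truncn (\sum_i `|x ord0 i|)).+1 => //= i.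
rewrite -ltr_norml (le_lt_trans _ (truncnS_gt _))//.
by rewrite (bigD1 i)//= lerDl sumr_ge0.
Qed.

(** A coordinate cylinder over []a, b[] is the union over [k] of the boxes with side []-k, k[] in
    the other coordinates, and open intervals generate the Borel sets. This makes the boxes
    available for uniqueness of measures and Dynkin induction. *)
Lemma measurable_open_boxes (R : realType) (n : nat) :
  @measurable _ 'rV[R]_n = <<s @open_boxes R n >>.
Proof.
apply/seteqP; split; last first.
  apply: smallest_sub; first exact: sigma_algebra_measurable.
  by move=> _ [a [b ->]]; exact: measurable_open_box.
apply: smallest_sub; first exact: smallest_sigma_algebra.
rewrite -bigcup_seq => _ [i _] [B mB <-]; rewrite setTI.
have mf : measurable_fun [set: g_sigma_algebraType (@open_boxes R n)]
    (fun x : 'rV[R]_n => (x ord0 i : measurableTypeR R)).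
  apply: (@measurability _ _ _ _ setT _ (@RGenOpens.G R)) => //.
    exact: RGenOpens.measurableE.
  move=> _ [_ [a [b ->]] <-]; rewrite setTI.
  rewrite (_ : _ @^-1` _ = \bigcup_k
      open_box (fun j => if j == i then a else - k%:R)
               (fun j => if j == i then b else k%:R)); last first.
    apply/seteqP; split => x /=.
      rewrite in_itv/= => xab.
      have [k _ xk] : (\bigcup_k @cube R n k) x by rewrite bigcup_cube.
      by exists k => // j; case: eqP => [->//|_]; exact: xk.
    by move=> [k _ /(_ i)]; rewrite eqxx in_itv.
  apply: bigcupT_measurable => k; apply: sub_sigma_algebra.
  by eexists; eexists.
by have := mf measurableT B mB; rewrite setTI.
Qed.

Lemma setI_closed_open_boxes (R : realType) (n : nat) :
  setI_closed (@open_boxes R n).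
Proof.
move=> _ _ [a [b ->]] [c [d ->]].
exists (fun i => Num.max (a i) (c i)), (fun i => Num.min (b i) (d i)).
apply/seteqP; split => x /=.
  move=> [xab xcd] i; have /andP[? ?] := xab i; have /andP[? ?] := xcd i.
  by rewrite gt_max lt_min; apply/andP; split; apply/andP.
move=> H; split => i; have := H i; rewrite gt_max lt_min;
  by move=> /andP[/andP[? ?] /andP[? ?]]; apply/andP.
Qed.

(** * Measure-preserving maps and translations *)

Section measure_preserving.
Context d1 d2 (X : measurableType d1) (Y : measurableType d2) (R : realType).
Variables (mu : {measure set X -> \bar R}) (nu : {measure set Y -> \bar R}).
Variable f : X -> Y.
Hypothesis mf : measurable_fun setT f.
Hypothesis f_pres : forall A, measurable A -> mu (f @^-1` A) = nu A.

Lemma ge0_integral_preserving (F : Y -> \bar R) :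
  measurable_fun setT F -> (forall y, (0 <= F y)%E) ->
  (\int[mu]_x F (f x) = \int[nu]_y F y)%E.
Proof.
move=> mF F0.
have := @ge0_integral_pushforward _ _ _ _ _ _ mf mu setT F measurableT mF.
rewrite preimage_setT => /(_ (fun y _ => F0 y)) <-.
by apply: eq_measure_integral => A mA _; exact: f_pres.
Qed.

Lemma integral_preserving (F : Y -> \bar R) :
  measurable_fun setT F -> (\int[mu]_x F (f x) = \int[nu]_y F y)%E.
Proof.
move=> mF; rewrite [LHS]integralE [RHS]integralE.
by congr (_ - _)%E; [under eq_integral do rewrite (funepos_comp F f)/=
  |under eq_integral do rewrite (funeneg_comp F f)/=];
  apply: ge0_integral_preserving => //;
  [exact: measurable_funepos|exact: measurable_funeneg].
Qed.

End measure_preserving.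

Lemma measurable_shift_rV (R : realType) (n : nat) (v : 'rV[R]_n) :
  measurable_fun setT (fun x : 'rV[R]_n => x + v).
Proof.
apply: measurable_fun_rV => i.
rewrite (_ : _ \o _ = fun x => rV_coord i x + v ord0 i); last first.
  by apply/funext => x; rewrite /rV_coord /= mxE.
apply: measurable_funD => //; exact: measurable_rV_coord.
Qed.

(** Both measures agree on open boxes and are finite on the cubes, which exhaust the space;
    uniqueness of measures concludes. *)
Lemma lebesgue_rV_shift (R : realType) (n : nat) (v : 'rV[R]_n) A :
  measurable A -> lebesgue_rV R n ((fun x => x + v) @^-1` A) = lebesgue_rV R n A.
Proof.
move=> mA.
have mv := @measurable_shift_rV R n v.
have := @measure_unique _ R _ _ (@cube R n) (@measurable_open_boxes R n)
  (@setI_closed_open_boxes R n) _ (@bigcup_cube R n)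
  (measure_function_pushforward__canonical__measure_function_Measure
    (lebesgue_rV R n) mv) (lebesgue_rV R n).
apply => //.
- by move=> k; exists (fun=> - k%:R), (fun=> k%:R).
- move=> _ [a [b ->]] /=; rewrite /pushforward.
  rewrite (_ : _ @^-1` _ = open_box (fun i => a i - v ord0 i)
                                    (fun i => b i - v ord0 i)); last first.
    by apply/seteqP; split => x /= H i; have := H i; rewrite !mxE
      ltrBlDr ltrBrDr.
  rewrite !lebesgue_rV_open_box; apply: eq_bigr => i _.
  by rewrite opprB addrA subrK.
- move=> k /=; rewrite /pushforward.
  rewrite (_ : _ @^-1` _ = open_box (fun i => - k%:R - v ord0 i)
                                    (fun i => k%:R - v ord0 i)); last first.
    by apply/seteqP; split => x /= H i; have := H i; rewrite !mxE
      ltrBlDr ltrBrDr.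
  exact: lebesgue_rV_open_box_lty.
Qed.

Lemma lebesgue_measure_shift (R : realType) (v : R)
    (A : set (measurableTypeR R)) : measurable A ->
  lebesgue_measure ((fun x => x + v) @^-1` A) = lebesgue_measure A.
Proof.
have mv : measurable_fun [set: measurableTypeR R]
  (fun x : measurableTypeR R => (x + v : measurableTypeR R)).
  exact: measurable_funD.
move=> mA; apply/esym.
apply: (@lebesgue_measure_unique R
  (measure_function_pushforward__canonical__measure_function_Measure
    lebesgue_measure mv)) => //= _ [[a b]] _ <-.
rewrite /pushforward (_ : _ @^-1` _ = `]a - v, b - v]%classic); last first.
  by apply/seteqP; split => x /=; rewrite !in_itv/= ltrBlDr lerBrDr.
rewrite !lebesgue_measure_itv/= !lte_fin ltrD2r.
by rewrite -!EFinB opprB addrA subrK.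
Qed.

(** * Test functions *)

Section flat_function.
Variable R : realType.
Implicit Types p : {poly R}.

(* The family is stable under derivation, which is what makes
   [flat 1 = exp (- 1 / t)] smooth at [0]. *)
Definition flat p (t : R) : R :=
  if 0 < t then p.[t^-1] * expR (- t^-1) else 0.

(** The exponential dominates its Taylor term y^n / n!. With y = 1/t this bounds each monomial of
    [flat p t] uniformly in t > 0. *)
Lemma expn_expRN_le (n : nat) (y : R) : 0 <= y -> y ^+ n * expR (- y) <= n`!%:R.
Proof.
move=> y0; rewrite expRN ler_pdivrMr ?expR_gt0//.
case: n => [|n]; first by rewrite expr0 fact0 mul1r -expR0 ler_expR.
have := expR_ge1Dxn n y0; rewrite -(ler_pM2l (x := n.+1`!%:R)) ?ltr0n ?fact_gt0//.
apply: le_trans; rewrite mulrDr mulr1 mulrCA divff ?mulr1 ?lerDr//.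
Qed.

Lemma flat_bounded p : exists C, forall t, `|flat p t| <= C.
Proof.
exists (\sum_(i < size p) `|p`_i| * i`!%:R) => t; rewrite /flat.
case: ifPn => [t0|_]; last by rewrite normr0 sumr_ge0// => i _; rewrite mulr_ge0.
rewrite horner_coef big_distrl/= (le_trans (ler_norm_sum _ _ _))//.
apply: ler_sum => i _; rewrite -mulrA normrM ler_wpM2l//.
have ti : 0 <= t^-1 by rewrite invr_ge0 ltW.
by rewrite ger0_norm ?expn_expRN_le// mulr_ge0 ?expR_ge0// exprn_ge0.
Qed.

(** For t > 0 the derivative of p(1/t) exp(-1/t) is t^-2 (p(1/t) - p'(1/t)) exp(-1/t), again a
    polynomial in 1/t times the same exponential. *)
Definition flat_deriv p : {poly R} := 'X^2 * (p - p^`()).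

(** For t > 0, [flat ('X^2 * p) t] is t^-2 times [flat p t], and it is bounded. The quadratic decay
    makes the difference quotient at 0 at most C |h|, whence a zero derivative there. *)
Lemma flat_quadratic p : exists C, forall t, `|flat p t| <= C * t ^+ 2.
Proof.
have [C HC] := flat_bounded ('X^2 * p); exists C => t.
have C0 : 0 <= C := le_trans (normr_ge0 _) (HC 0).
have := HC t; rewrite /flat; case: ifPn => [t0|_ _]; last first.
  by rewrite normr0 mulr_ge0// sqr_ge0.
rewrite hornerM hornerXn -mulrA normrM ger0_norm ?sqr_ge0//.
by rewrite exprVn ler_pdivrMl ?exprn_gt0// [_ * C]mulrC.
Qed.

Lemma is_derive_flat p (t : R) : is_derive t 1 (flat p) (flat (flat_deriv p) t).
Proof.
have [t0|t0|->] := ltgtP t 0.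
- apply: (@near_eq_is_derive _ _ _ (cst 0)).
    near=> x; rewrite /flat ifF//; apply/negbTE; rewrite -leNgt ltW//.
    by near: x; exact: lt_nbhsl.
  by rewrite /flat ifF ?ltNge ?(ltW t0)//; exact: is_derive_cst.
- have nf : \forall x \near t, p.[x^-1] * expR (- x^-1) = flat p x.
    near=> x; rewrite /flat ifT//.
    by near: x; exact: lt_nbhsr.
  apply: (near_eq_is_derive nf).
  have tn0 : t != 0 by rewrite gt_eqF.
  have dV : is_derive t 1 (fun x : R => x^-1) (- t ^- 2).
    have dd := @derivableV R R id t 1 tn0 (@derivable_id _ _ _ _).
    apply: DeriveDef => //.
    by rewrite (@deriveV R R id)// derive_id scaler1.
  have dNV : is_derive t 1 (fun x : R => - x^-1) (- - t ^- 2).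
    by have := is_deriveN dV.
  have d1 : is_derive t 1 (fun x : R => p.[x^-1]) (p^`().[t^-1] * (- t ^- 2)).
    exact: (@is_derive1_comp _ (horner p) (fun x => x^-1)).
  have d2 : is_derive t 1 (fun x : R => expR (- x^-1)) (expR (- t^-1) * - - t^-2).
    exact: (@is_derive1_comp _ expR (fun x => - x^-1)).
  apply: (is_derive_eq (is_deriveM d1 d2)).
  rewrite /flat t0 /flat_deriv hornerM hornerD hornerN hornerXn exprVn /=.
  by rewrite /GRing.scale/=; ring.
- have [C HC] := flat_quadratic p.
  have C0 : 0 <= C by move: (HC 1); rewrite expr1n mulr1; apply: le_trans.
  have f0 q : flat q 0 = 0 by rewrite /flat ltxx.
  rewrite f0.
  have cv : (fun h : R => h^-1 *: ((flat p \o shift 0) (h *: 1) - flat p 0))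
      @ 0^' --> (0 : R).
    apply/cvgrPdist_le => e e0; near=> h.
    rewrite sub0r normrN f0 subr0 /= addr0 [_ *: 1]mulr1 normrZ.
    have h0 : h != 0 by near: h; exact: nbhs_dnbhs_neq.
    rewrite normfV ler_pdivrMl ?normr_gt0// (le_trans (HC _))//.
    rewrite -real_normK ?num_real// expr2 mulrA mulrC ler_wpM2l//.
    (* [C] may be 0; [C + 1] can be divided by. *)
    rewrite (@le_trans _ _ ((C + 1) * `|h|))// ?ler_wpM2r ?lerDl//.
    rewrite -ler_pdivlMl ?ltr_wpDl//.
    near: h; apply: dnbhs0_le; rewrite mulr_gt0// invr_gt0 ltr_wpDl//.
  by split; [apply/cvg_ex; exists 0|exact/cvg_lim].
Unshelve. all: by end_near. Qed.

Lemma continuous_flat p : continuous (flat p).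
Proof.
move=> t; apply/differentiable_continuous/derivable1_diffP.
by have [] := is_derive_flat p t.
Qed.

End flat_function.

(** The two difference quotients are the same function of [h]; directional derivatives thus reduce
    to derivatives in one real variable. *)
Lemma is_derive_along (R : realType) (n : nat) (f : 'rV[R]_n -> R)
    (v y : 'rV[R]_n) (t d : R) :
  is_derive (t *: v + y) v f d <-> is_derive t 1 (fun s => f (s *: v + y)) d.
Proof.
have E : (fun h : R => h^-1 *: ((f \o shift (t *: v + y)) (h *: v)
      - f (t *: v + y))) =
    (fun h : R => h^-1 *: (((fun s => f (s *: v + y)) \o shift t) (h *: 1)
      - f (t *: v + y))).
  by apply/funext => h /=; rewrite [_ *: 1]mulr1 scalerDl addrA.
by split=> -[]; rewrite /derivable/derive => H1 H2; apply: DeriveDef;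
  rewrite /derivable/derive; [rewrite -E|rewrite -E|rewrite E|rewrite E].
Qed.

Lemma coord_scaleD (R : realType) (n : nat) (v y : 'rV[R]_n) (s : R) i :
  (s *: v + y) ord0 i = s * v ord0 i + y ord0 i.
Proof. by rewrite !mxE. Qed.

(* All members are bounded, and the class is stable under partial derivatives
   and translations, so membership alone gives smoothness. *)
Inductive flat_algebra (R : realType) (n : nat) : ('rV[R]_n -> R) -> Prop :=
| flat_alg_base p a i b : flat_algebra (fun x => flat p (a * x ord0 i + b))
| flat_alg_cst c : flat_algebra (fun=> c)
| flat_alg_add f g :
    flat_algebra f -> flat_algebra g -> flat_algebra (fun x => f x + g x)
| flat_alg_mul f g :
    flat_algebra f -> flat_algebra g -> flat_algebra (fun x => f x * g x).

Section flat_algebra.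
Variables (R : realType) (n : nat).
Implicit Types f g : 'rV[R]_n -> R.

(** The form linear in [v] gives the derivative in the direction [u] as well as the partial
    derivatives; keeping each [D i] in the class lets the lemma be iterated. *)
Lemma flat_algebra_derive f : flat_algebra f ->
  exists D : 'I_n -> 'rV[R]_n -> R, (forall i, flat_algebra (D i)) /\
    forall x v, is_derive x v f (\sum_i v ord0 i * D i x).
Proof.
elim => {f} [p a i b|c|f g _ [Df [eDf Hf]] _ [Dg [eDg Hg]]
            |f g ef [Df [eDf Hf]] eg [Dg [eDg Hg]]].
- exists (fun j x => (if j == i then a else 0)
    * flat (flat_deriv p) (a * x ord0 i + b)); split => [j|x v].
    by apply: flat_alg_mul; [exact: flat_alg_cst|exact: flat_alg_base].
  have -> : x = 0 *: v + x by rewrite scale0r add0r.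
  apply/is_derive_along.
  rewrite (bigD1 i)//= eqxx big1 ?addr0 => [|j /negbTE ->]; last first.
    by rewrite mul0r mulr0.
  pose q : {poly R} := (a * v ord0 i) *: 'X + (a * x ord0 i + b)%:P.
  rewrite (_ : (fun s : R => _) = flat p \o horner q); last first.
    apply/funext => s /=; 
      rewrite coord_scaleD hornerD hornerZ hornerX hornerC; congr flat; ring.
  apply: (is_derive_eq (is_derive1_comp (is_derive_flat p _) (is_derive_poly q 0))).
  rewrite hornerD hornerZ hornerX hornerC.
  rewrite derivD derivZ derivX derivC addr0 hornerZ hornerC.
  rewrite scale0r add0r mulr0 add0r; ring.
- exists (fun _ _ => 0); split => [i|x v]; first exact: flat_alg_cst.
  by rewrite big1; [exact: is_derive_cst|move=> i _; rewrite mulr0].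
- exists (fun i x => Df i x + Dg i x); split => [i|x v].
    exact: flat_alg_add.
  apply: (is_derive_eq (is_deriveD (Hf x v) (Hg x v))).
  by rewrite -big_split; apply: eq_bigr => i _; rewrite /= mulrDr.
- exists (fun i x => f x * Dg i x + g x * Df i x); split => [i|x v].
    by apply: flat_alg_add; apply: flat_alg_mul.
  apply: (is_derive_eq (is_deriveM (Hf x v) (Hg x v))).
  rewrite /GRing.scale/= !big_distrr/= -big_split; apply: eq_bigr => i _ /=.
  by ring.
Qed.

Lemma flat_algebra_shift f v :
  flat_algebra f -> flat_algebra (fun x => f (x + v)).
Proof.
elim => {f} [p a i b|c|f g _ ef _ eg|f g _ ef _ eg].
- rewrite (_ : (fun x => _) =
    (fun x : 'rV[R]_n => flat p (a * x ord0 i + (a * v ord0 i + b)))).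
    exact: flat_alg_base.
  by apply/funext => x; rewrite !mxE mulrDr addrA.
- exact: flat_alg_cst.
- exact: flat_alg_add.
- exact: flat_alg_mul.
Qed.

Lemma flat_algebra_bounded f : flat_algebra f -> exists C, forall x, `|f x| <= C.
Proof.
elim => {f} [p a i b|c|f g _ [C HC] _ [D HD]|f g _ [C HC] _ [D HD]].
- by have [C HC] := flat_bounded p; exists C.
- by exists `|c|.
- by exists (C + D) => x; rewrite (le_trans (ler_normD _ _))// lerD.
- by exists (C * D) => x; rewrite normrM ler_pM.
Qed.

Lemma flat_algebra_continuous f : flat_algebra f -> continuous f.
Proof.
elim => {f} [p a i b|c|f g _ ef _ eg|f g _ ef _ eg] x.
- have FF : Filter (nbhs (x : 'rV[R]_n)) := nbhs_filter x.
  have cl : (fun y : 'rV[R]_n => a * y ord0 i + b) @ x --> a * x ord0 i + b.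
    apply: (cvgD (FF := FF)); last exact: cvg_cst.
    apply: (cvgM (FF := FF)); first exact: cvg_cst.
    exact: coord_continuous.
  exact: (continuous_comp cl (@continuous_flat R p _)).
- exact: cst_continuous.
- by apply: continuousD; [exact: ef|exact: eg].
- by apply: continuousM; [exact: ef|exact: eg].
Qed.

Lemma flat_algebra_measurable f : flat_algebra f -> measurable_fun setT f.
Proof.
elim => {f} [p a i b|c|f g _ ef _ eg|f g _ ef _ eg].
- apply: (@measurableT_comp _ _ _ _ _ _ (flat p)).
    by apply: continuous_measurable_fun; exact: continuous_flat.
  apply: measurable_funD => //; apply: measurable_funM => //.
  exact: measurable_rV_coord.
- exact: measurable_cst.
- exact: measurable_funD.
- exact: measurable_funM.
Qed.

Lemma partial_directional f (D : 'I_n -> 'rV[R]_n -> R) :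
  (forall x v, is_derive x v f (\sum_i v ord0 i * D i x)) ->
  forall i, partial i f = D i.
Proof.
move=> HD i; apply/funext => x; rewrite /partial.
rewrite (@derive_val _ _ _ _ _ _ _ (HD x (delta_mx ord0 i))).
rewrite (bigD1 i)//= mxE !eqxx mul1r big1 ?addr0// => j ji.
by rewrite mxE (negbTE ji) mul0r.
Qed.

Lemma flat_algebra_smooth f : flat_algebra f -> smooth f.
Proof.
move=> ef s.
have es : flat_algebra (iter_partial s f).
  elim: s => //= i s es; have [D [eD HD]] := flat_algebra_derive es.
  by rewrite (partial_directional HD).
split; first exact: flat_algebra_continuous.
move=> i x; have [D [eD HD]] := flat_algebra_derive es.
by have [] := HD x (delta_mx ord0 i).
Qed.

Definition bounded_support f :=
  exists M : R, forall x : 'rV[R]_n, (exists i, M < `|x ord0 i|) -> f x = 0.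

Definition flat_test f := flat_algebra f /\ bounded_support f.

(** The support lies in the closed ball of radius [|M|] for the sup norm, so its closure is closed
    and bounded. *)
Lemma flat_test_function f : flat_test f -> test_function f.
Proof.
move=> [ef [M fM]]; split; first exact: flat_algebra_smooth.
apply: bounded_closed_compact; last exact: closed_closure.
have sub : closure [set x | f x != 0] `<=` closed_ball_ (@Num.norm _ _) 0 `|M|.
  rewrite [X in _ `<=` X](closure_id _).1; last exact: closed_closed_ball_.
  apply: closureS => x /= fx; rewrite /closed_ball_/= sub0r normrN.
  rewrite [leLHS]/Num.norm/= mx_normrE; apply/bigmax_leP; split => //= -[j i] _ /=.
  rewrite leNgt; apply/negP => Mx; move/eqP: fx; apply; apply: fM; exists i.
  by rewrite (le_lt_trans (ler_norm _))// (lt_le_trans Mx)// (ord1 j).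
exists `|M|; split => [|r Mr x /sub]; first exact: num_real.
by rewrite /closed_ball_/= sub0r normrN => xM; rewrite (le_trans xM)// ltW.
Qed.

Lemma flat_test_shift f v : flat_test f -> flat_test (fun x => f (x + v)).
Proof.
move=> [ef [M fM]]; split; first exact: flat_algebra_shift.
exists (M + \sum_i `|v ord0 i|) => x [i xi]; apply: fM; exists i.
rewrite mxE -(ltrD2r (\sum_i `|v ord0 i|)) (lt_le_trans xi)//.
rewrite (@le_trans _ _ (`|x ord0 i + v ord0 i| + `|v ord0 i|))//.
  by rewrite -[X in `|X| <= _](addrK (v ord0 i)) -(normrN (v ord0 i)) ler_normD.
by rewrite lerD2l (bigD1 i)//= lerDl sumr_ge0.
Qed.

Lemma flat_test_derive f : flat_test f ->
  exists D : 'I_n -> 'rV[R]_n -> R, [/\ forall i, flat_test (D i),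
    forall i, partial i f = D i &
    forall x v, is_derive x v f (\sum_i v ord0 i * D i x)].
Proof.
move=> [ef [M fM]]; have [D [eD HD]] := flat_algebra_derive ef.
have fD := partial_directional HD.
exists D; split => // i; split => //; exists M => x [j Mx].
(* The condition [M < |x_j|] is open, so [f] vanishes in a neighbourhood of [x] and its derivative
   is 0 there. *)
rewrite -fD /partial (@near_eq_derive _ _ _ _ (cst 0)) ?derive_cst//.
have : (fun y : 'rV[R]_n => `|y ord0 j|) @ x --> `|x ord0 j|.
  exact: (cvg_norm (@coord_continuous R 1 n ord0 j x)).
move=> /cvgr_gt/(_ _ Mx); apply: filterS => y My; apply: fM.
by exists j.
Qed.

End flat_algebra.

(** * The fundamental lemma of the calculus of variations *)

Lemma flat1_itv (R : realType) (t : R) : 0 <= flat 1 t <= 1.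
Proof.
rewrite /flat; case: ifPn => [t0|_]; last by rewrite lexx ler01.
by rewrite hornerC mul1r expR_ge0 -expR0 ler_expR oppr_le0 invr_ge0 ltW.
Qed.

Lemma flat1_le0 (R : realType) (t : R) : t <= 0 -> flat 1 t = 0.
Proof. by move=> t0; rewrite /flat ltNge t0. Qed.

Lemma flat1_cvg (R : realType) (t : R) : 0 < t ->
  flat 1 (k.+1%:R * t) @[k --> \oo] --> (1 : R).
Proof.
move=> t0; rewrite (_ : (fun k : nat => _) =
  fun k : nat => expR ((- t^-1) * k.+1%:R^-1)); last first.
  apply/funext => k; rewrite /flat mulr_gt0// hornerC mul1r invfM mulNr.
  by congr (expR (- _)); rewrite mulrC.
rewrite -[X in _ --> X]expR0; apply: continuous_cvg; first exact: continuous_expR.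
rewrite -[X in _ --> X](mulr0 (- t^-1)); apply: cvgM; first exact: cvg_cst.
exact: (@cvg_harmonic R).
Qed.

Section box_bump.
Variables (R : realType) (n : nat) (a b : 'I_n -> R).

(** Since exp(-1/((k+1) t)) tends to 1 for t > 0, these functions, with values in [0, 1], tend
    pointwise to the indicator of the open box as [k] grows. *)
Definition box_bump (k : nat) (x : 'rV[R]_n) : R := \prod_(i < n)
  (flat 1 (k.+1%:R * (x ord0 i - a i)) * flat 1 (k.+1%:R * (b i - x ord0 i))).

Lemma box_bump_itv k x : 0 <= box_bump k x <= 1.
Proof.
have H i : 0 <= flat 1 (k.+1%:R * (x ord0 i - a i))
     * flat 1 (k.+1%:R * (b i - x ord0 i)) <= 1.
  have /andP[p0 p1] := flat1_itv (k.+1%:R * (x ord0 i - a i)).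
  have /andP[q0 q1] := flat1_itv (k.+1%:R * (b i - x ord0 i)).
  by rewrite mulr_ge0//= mulr_ile1.
apply/andP; split; first by apply: prodr_ge0 => i _; case/andP: (H i).
by apply: prodr_ile1 => i _; exact: H.
Qed.

Lemma box_bump_out k x : ~ open_box a b x -> box_bump k x = 0.
Proof.
move=> /existsNP[i /negP]; rewrite negb_and -!leNgt => abi.
rewrite /box_bump (bigD1 i)//=; case/orP: abi => H.
  by rewrite flat1_le0 ?mul0r// pmulr_rle0// subr_le0.
by rewrite mulrC (flat1_le0 (t := _ * (b i - _))) ?mulr0// pmulr_rle0// subr_le0.
Qed.

Lemma box_bump_cvg x : open_box a b x -> box_bump k x @[k --> \oo] --> (1 : R).
Proof.
move=> xab; rewrite /box_bump.
have E1 : (1 : R) = \prod_(i < n) (1 * 1).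
  by rewrite big1// => i _; rewrite mulr1.
rewrite [X in _ --> X]E1.
apply: (@cvg_big R 'I_n *%R 1 predT (@mul_continuous R) nat \oo _
  (fun i k => flat 1 (k.+1%:R * (x ord0 i - a i))
    * flat 1 (k.+1%:R * (b i - x ord0 i))) (fun=> 1 * 1)) => i _.
 have /andP[ai bi] := xab i.
by apply: cvgM; apply: flat1_cvg; rewrite subr_gt0.
Qed.

Lemma flat_algebra_prod (s : seq 'I_n) (F : 'I_n -> 'rV[R]_n -> R) :
  (forall i, flat_algebra (F i)) -> flat_algebra (fun x => \prod_(i <- s) F i x).
Proof.
move=> eF; elim: s => [|i s IH].
  rewrite (_ : (fun x => _) = fun=> 1); first exact: flat_alg_cst.
  by apply/funext => x; rewrite big_nil.
rewrite (_ : (fun x => _) = fun x => F i x * \prod_(j <- s) F j x).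
  exact: flat_alg_mul.
by apply/funext => x; rewrite big_cons.
Qed.

Lemma box_bump_test k : flat_test (box_bump k).
Proof.
split.
  apply: flat_algebra_prod => i; apply: flat_alg_mul.
    rewrite (_ : (fun x => _) = fun x : 'rV[R]_n =>
      flat 1 (k.+1%:R * x ord0 i + - (k.+1%:R * a i))).
      exact: flat_alg_base.
    by apply/funext => x; rewrite mulrBr.
  rewrite (_ : (fun x => _) = fun x : 'rV[R]_n =>
    flat 1 (- k.+1%:R * x ord0 i + (k.+1%:R * b i))).
    exact: flat_alg_base.
  by apply/funext => x; rewrite mulrBr mulNr addrC.
exists (\sum_i (`|a i| + `|b i|)) => x [i Mx]; apply: box_bump_out => /(_ i).
move=> /andP[ai bi]; move: Mx; apply/negP; rewrite -leNgt.
rewrite (@le_trans _ _ (`|a i| + `|b i|))//; last first.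
  by rewrite (bigD1 i)//= lerDl sumr_ge0// => j _; rewrite addr_ge0.
rewrite ler_norml; apply/andP; split.
  rewrite opprD (le_trans _ (ltW ai))// (@le_trans _ _ (- `|a i|))//.
    by rewrite gerDl oppr_le0.
  by rewrite lerNl -normrN ler_norm.
by rewrite (le_trans (ltW bi))// (le_trans (ler_norm _))// lerDr.
Qed.

End box_bump.

Lemma open_box_sub_cube (R : realType) (n : nat) (a b : 'I_n -> R) :
  exists k, open_box a b `<=` @cube R n k.
Proof.
have M0 i : `|a i| + `|b i| <= (Num.Def.truncn (\sum_i (`|a i| + `|b i|))).+1%:R.
  rewrite ltW// (le_lt_trans _ (truncnS_gt _))// (bigD1 i)//= lerDl sumr_ge0//.
exists (Num.Def.truncn (\sum_i (`|a i| + `|b i|))).+1 => x xab i.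
have /andP[ai bi] := xab i; apply/andP; split.
  rewrite (le_lt_trans _ ai)// lerNl (le_trans _ (M0 i))//.
  by rewrite -normrN (le_trans (ler_norm _))// lerDl.
by rewrite (lt_le_trans bi)// (le_trans _ (M0 i))// (le_trans (ler_norm _))// lerDr.
Qed.

Section fundamental_lemma.
Variables (R : realType) (n : nat) (w : 'rV[R]_n -> R).
Let mu := lebesgue_rV R n.
Hypothesis mw : measurable_fun setT w.
Hypothesis iw : forall k, mu.-integrable (@cube R n k) (EFin \o w).
Hypothesis w_test : forall psi, flat_test psi ->
  (\int[mu]_x (w x * psi x)%:E = 0)%E.

Let integrable_open_box a b : mu.-integrable (open_box a b) (EFin \o w).
Proof.
have [k sub] := open_box_sub_cube a b.
by apply: integrableS (iw k) => //; exact: measurable_open_box.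
Qed.

(** Dominated convergence for [w * box_bump a b k], with [|w|] as the dominating function; each of
    these integrals vanishes by [w_test]. *)
Let integral_open_box a b : (\int[mu]_(x in open_box a b) (w x)%:E = 0)%E.
Proof.
have mB := measurable_open_box a b.
have mwB : measurable_fun (open_box a b) w by exact: measurable_funTS.
have mb k : measurable_fun setT (box_bump a b k).
  by have [e _] := box_bump_test a b k; exact: flat_algebra_measurable.
have := @dominated_convergence _ _ _ mu _ mB
  (fun k x => (w x * box_bump a b k x)%:E) (fun x => (w x)%:E)
  (fun x => `|(w x)%:E|%E).
case.
- move=> k; apply/measurable_EFinP; apply: measurable_funM => //.
  exact: measurable_funTS.
- exact/measurable_EFinP.
- apply: aeW => x xB; apply: cvg_EFin; first by apply: nearW.
  rewrite -[X in _ --> X]mulr1; apply: cvgM; first exact: cvg_cst.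
  exact: box_bump_cvg.
- exact: integrable_abse.
- apply: aeW => x k xB; rewrite lee_fin normrM ler_piMr//.
  by have /andP[H0 H1] := box_bump_itv a b k x; rewrite ger0_norm.
move=> _ _.
rewrite (_ : (fun k => _) = fun=> 0%E); last first.
  apply/funext => k; rewrite integral_mkcond -[RHS](w_test (box_bump_test a b k)).
  apply: eq_integral => x _; rewrite patchE; case: ifPn => // /negP xB.
  by rewrite box_bump_out ?mulr0// => xB'; apply: xB; rewrite inE.
by move=> /(cvg_unique _ (cvg_cst _)) -/(_ _) <-.
Qed.

(** For a fixed cube, the sets [E] such that [w] has zero integral over [E] cut by the cube form a
    Dynkin system containing the boxes, hence all measurable sets. So [w] vanishes almost everywhere
    on each cube, and the cubes cover the space. *)
Lemma fundamental_lemma : {ae mu, forall x, w x = 0}.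
Proof.
have H k : {ae mu, forall x, @cube R n k x -> w x = 0}.
  have mD : measurable (@cube R n k) by exact: measurable_open_box.
  have P E : measurable E -> (\int[mu]_(x in E `&` @cube R n k) (w x)%:E = 0)%E.
    rewrite [X in X E]measurable_open_boxes; move: E.
    apply: (@dynkin_induction _ _ (@open_boxes R n)
      (fun E => \int[mu]_(x in E `&` @cube R n k) (w x)%:E = 0)%E).
    - exact: measurable_open_boxes.
    - exact: setI_closed_open_boxes.
    - by rewrite setTI integral_open_box.
    - move=> E EG.
      have [a [b ->]] : @open_boxes R n (E `&` @cube R n k).
        apply: setI_closed_open_boxes => //.
        by exists (fun=> - k%:R), (fun=> k%:R).
      exact: integral_open_box.
    - move=> E mE E0.
      have : (\int[mu]_(x in @cube R n k) (w x)%:E = 0)%E by exact: integral_open_box.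
      rewrite -{1}(setIT (@cube R n k)) setIC -(setUv E) setIUl integral_setU//.
      + by rewrite E0 add0e.
      + exact: measurableI.
      + by apply: measurableI => //; exact: measurableC.
      + by apply/measurable_EFinP; exact: measurable_funTS.
      + apply/disj_setPS => x [[Ex _] [nEx _]]; exact: nEx.
    - move=> F mF tF F0; rewrite setI_bigcupl integral_bigcup.
      + by rewrite eseries0.
      + exact: trivIset_setIr.
      + by move=> i; exact: measurableI.
      + apply: integrableS (iw k) => //.
          by apply: bigcupT_measurable => i; exact: measurableI.
        by move=> x [i _ []].
  have := @integral_ae_eq _ _ _ mu _ mD (cst 0%E) _ (iw k) (measurable_cst _).
  case.
    move=> E sE mE; rewrite integral0 -(P _ mE).
    by have /setIidPl -> := sE.
  move=> N [mN N0 sN]; exists N; split => // x /= xN; apply: sN => /= h.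
  by apply: xN => xD; have [] := h xD.
apply: filterS (ae_foralln H) => x Hx.
have [k _ xk] : (\bigcup_k @cube R n k) x by rewrite bigcup_cube.
exact: Hx xk.
Qed.

End fundamental_lemma.

(** * Integrability on products *)

Section product_facts.
Context d1 d2 (T1 : measurableType d1) (T2 : measurableType d2) (R : realType).
Variables (m1 : {sigma_finite_measure set T1 -> \bar R}).
Variables (m2 : {sigma_finite_measure set T2 -> \bar R}).

Lemma measurable_section_integral (f : T1 * T2 -> \bar R) :
  measurable_fun setT f -> measurable_fun setT (fun x => (\int[m2]_y f (x, y))%E).
Proof.
move=> mf; rewrite (_ : (fun x => _) = (fun x =>
    (\int[m2]_y f^\+ (x, y)) - \int[m2]_y f^\- (x, y))%E); last first.
  apply/funext => x; rewrite [LHS]integralE.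
  under eq_integral do rewrite (funepos_comp f)/=.
  by under [X in (_ - X)%E = _]eq_integral do rewrite (funeneg_comp f)/=.
apply: emeasurable_funB; apply: measurable_fun_fubini_tonelli_F => //.
  exact: measurable_funepos.
exact: measurable_funeneg.
Qed.

(* Tonelli applied to the indicator of the exceptional set. *)
Lemma ae_exchange (P : T1 -> T2 -> Prop) :
  measurable [set z : T1 * T2 | ~ P z.1 z.2] ->
  (forall y, {ae m1, forall x, P x y}) -> {ae m1, forall x, {ae m2, forall y, P x y}}.
Proof.
move=> mE hP; set E := [set z | _] in mE.
have mI : measurable_fun setT (fun z => (\1_E z : R)%:E).
  by apply/measurable_EFinP; exact: measurable_indic.
have I0 z : (0 <= (\1_E z : R)%:E)%E by rewrite lee_fin.
have mG : measurable_fun setT (fun x => \int[m2]_y (\1_E (x, y) : R)%:E)%E.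
  exact: (measurable_section_integral mI).
have : (\int[m1]_x `|\int[m2]_y (\1_E (x, y) : R)%:E| = 0)%E.
  under eq_integral => x _ do rewrite gee0_abs ?integral_ge0//.
  rewrite (fubini_tonelli (fun z => (\1_E z : R)%:E))//.
  apply: integral0_eq => y _.
  have mJ : measurable_fun setT (fun x => (\1_E (x, y) : R)%:E).
    exact: (measurable_fun_pair1 y mI).
  have := ae_eq_integral_abs m1 measurableT mJ.
  under eq_integral => x _ do rewrite gee0_abs//.
  move=> ->; apply: filterS (hP y) => x Pxy _ /=.
  by rewrite indicE memNset//= => /(_ Pxy).
move/(ae_eq_integral_abs m1 measurableT mG); apply: filterS => x /= /(_ I).
have mJ : measurable_fun setT (fun y => (\1_E (x, y) : R)%:E).
  exact: (measurable_fun_pair2 x mI).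
have := ae_eq_integral_abs m2 measurableT mJ.
under eq_integral => y _ do rewrite gee0_abs//.
move=> [H _] /H; apply: filterS => y /= /(_ I).
rewrite indicE; have [//|/negP xyE] := boolP ((x, y) \in E).
  by move=> _ [] /eqP; rewrite oner_eq0.
by move=> _; apply: contrapT => nP; apply: xyE; rewrite inE.
Qed.

End product_facts.

(** * Square-integrable functions *)

Definition square_integrable d (T : measurableType d) (R : realType)
    (mu : {measure set T -> \bar R}) (f : T -> R) :=
  measurable_fun setT f /\ (\int[mu]_x (f x ^+ 2)%:E < +oo)%E.

Section square_integrable.
Context d (T : measurableType d) (R : realType) (mu : {measure set T -> \bar R}).
Implicit Types f g : T -> R.

Lemma normM_le_sqD (x y : R) : `|x * y| <= x ^+ 2 + y ^+ 2.
Proof.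
rewrite normrM -(real_normK (num_real x)) -(real_normK (num_real y)).
by have := sqr_ge0 (`|x| - `|y|); have := normr_ge0 x; have := normr_ge0 y; nra.
Qed.

Lemma square_integrableP f : measurable_fun setT f ->
  square_integrable mu f <-> mu.-integrable setT (fun x => (f x ^+ 2)%:E).
Proof.
move=> mf; split => [[_ H]|/integrableP[_ H]].
  apply/integrableP; split; first by apply/measurable_EFinP; exact: measurable_funX.
  by under eq_integral => x _ do rewrite gee0_abs ?lee_fin ?sqr_ge0//.
split => //.
rewrite (eq_integral (fun x => `|(f x ^+ 2)%:E|%E))// => x _.
by rewrite gee0_abs// lee_fin sqr_ge0.
Qed.

Lemma square_integrable_sqr f : square_integrable mu f ->
  mu.-integrable setT (fun x => (f x ^+ 2)%:E).
Proof. by move=> sf; apply/square_integrableP => //; case: sf. Qed.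

Lemma square_integrable_mul f g : square_integrable mu f ->
  square_integrable mu g -> mu.-integrable setT (fun x => (f x * g x)%:E).
Proof.
move=> sf sg; have [mf _] := sf; have [mg _] := sg.
apply: (@le_integrable _ _ _ _ _ _ _
  (fun x => (f x ^+ 2)%:E + (g x ^+ 2)%:E)%E) => //.
- by apply/measurable_EFinP; exact: measurable_funM.
- move=> x _; rewrite -EFinD/= !lee_fin.
  by rewrite (le_trans (normM_le_sqD _ _))// ler_norm.
- by apply: integrableD => //; exact: square_integrable_sqr.
Qed.

Lemma le_square_integrable f g : measurable_fun setT f ->
  (forall x, `|f x| <= `|g x|) -> square_integrable mu g -> square_integrable mu f.
Proof.
move=> mf fg [mg ig]; split => //; apply: le_lt_trans ig.
apply: ge0_le_integral => //.
- by move=> x _; rewrite lee_fin sqr_ge0.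
- by apply/measurable_EFinP; exact: measurable_funX.
- by apply/measurable_EFinP; exact: measurable_funX.
- move=> x _; rewrite lee_fin -(real_normK (num_real (f x))).
  by rewrite -(real_normK (num_real (g x))) lerXn2r// nnegrE.
Qed.

Lemma square_integrable_scale (k : R) f :
  square_integrable mu f -> square_integrable mu (fun x => k * f x).
Proof.
move=> sf; have [mf _] := sf.
apply/square_integrableP; first exact: measurable_funM.
rewrite (_ : (fun x => _) = (fun x => (k ^+ 2)%:E * (f x ^+ 2)%:E)%E); last first.
  by apply/funext => x; rewrite exprMn EFinM.
by apply: integrableZl => //; exact: square_integrable_sqr.
Qed.

Lemma square_integrableD f g : square_integrable mu f -> square_integrable mu g ->
  square_integrable mu (fun x => f x + g x).
Proof.
move=> sf sg; have [mf _] := sf; have [mg _] := sg.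
apply/square_integrableP; first exact: measurable_funD.
apply: (@le_integrable _ _ _ _ _ _ _
  (fun x => 2%:E * ((f x ^+ 2)%:E + (g x ^+ 2)%:E))%E) => //.
- by apply/measurable_EFinP; apply: measurable_funX; exact: measurable_funD.
- move=> x _; rewrite /= lee_fin.
  rewrite ger0_norm ?sqr_ge0// (le_trans _ (ler_norm _))// -subr_ge0.
  by rewrite (_ : _ - _ = (f x - g x) ^+ 2) ?sqr_ge0//; ring.
- by apply: integrableZl => //; apply: integrableD => //;
    exact: square_integrable_sqr.
Qed.

Lemma square_integrable_sum (I : Type) (s : seq I) (F : I -> T -> R) :
  (forall i, square_integrable mu (F i)) ->
  square_integrable mu (fun x => \sum_(i <- s) F i x).
Proof.
move=> sF; elim: s => [|i s IH].
  rewrite (_ : (fun x => _) = fun=> 0).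
    split; first exact: measurable_cst.
    by under eq_integral do rewrite expr0n/=; rewrite integral0.
  by apply/funext => x; rewrite big_nil.
rewrite (_ : (fun x => _) = fun x => F i x + \sum_(j <- s) F j x).
  exact: square_integrableD.
by apply/funext => x; rewrite big_cons.
Qed.

Lemma square_integrable_indic (A : set T) : measurable A -> (mu A < +oo)%E ->
  square_integrable mu \1_A.
Proof.
move=> mA Aoo; split; first exact: measurable_indic.
under eq_integral => x _.
  rewrite (_ : _ ^+ 2 = \1_A x); last by rewrite indicE; case: (_ \in _);
    rewrite ?expr1n ?expr0n.
  over.
by rewrite integral_indic// setIT.
Qed.

Lemma Lfun2_square_integrable f : f \in Lfun mu 2%:E <-> square_integrable mu f.
Proof.
split => [f2|sf].
  apply/square_integrableP; last exact: Lfun2_integrable_sqr.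
  by move: f2; rewrite inE => /andP[/[!inE]].
have [mf lf] := sf.
rewrite inE; apply/andP; split; rewrite inE//=.
rewrite /finite_norm unlock/=.
rewrite poweR_lty// (le_lt_trans _ lf)//.
under eq_integral => x _ do rewrite powR_mulrn// real_normK ?num_real//.
exact: lexx.
Qed.

End square_integrable.

Section line_facts.
Variable R : realType.
Local Notation lam := (@lebesgue_measure R).

Lemma is_derive_continuous (F f : R -> R) :
  (forall x : R, is_derive x 1 F (f x)) -> continuous F.
Proof.
move=> dF x; apply/differentiable_continuous/derivable1_diffP.
by have [] := dF x.
Qed.

Lemma integral_indic_mul (D : set (measurableTypeR R)) (f : R -> R) :
  (\int[lam]_r (\1_D r * f r)%:E = \int[lam]_(r in D) (f r)%:E)%E.
Proof.
rewrite [RHS]integral_mkcond; apply: eq_integral => r _.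
by rewrite patchE indicE; case: (r \in D); rewrite ?mul1r ?mul0r.
Qed.

(** The interval enters through its indicator so that the integral runs over the whole line, the
    form in which Fubini is applied below. *)
Lemma integral_derivative (F f : R -> R) (a b : R) :
  (forall x : R, is_derive x 1 F (f x)) -> continuous f -> a <= b ->
  (\int[lam]_r (\1_(`[a, b]%classic) r * f r)%:E = (F b - F a)%:E)%E.
Proof.
move=> dF cf; rewrite integral_indic_mul le_eqVlt => /predU1P[->|ab].
  by rewrite set_itv1 integral_set1 subrr.
have cF := is_derive_continuous dF.
rewrite EFinB; apply: continuous_FTC2 => //.
- by apply: continuous_subspaceT.
- split.
  + by move=> x _; have [] := dF x.
  + exact/cvg_at_right_filter/cF.
  + exact/cvg_at_left_filter/cF.
- by move=> x _; rewrite derive1E; exact: derive_val.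
Qed.

Lemma continuous_measurable_R (f : R -> R) : continuous f ->
  measurable_fun [set: measurableTypeR R] (f : measurableTypeR R -> R).
Proof. exact: continuous_measurable_fun. Qed.

Lemma lebesgue_itv_lty (a b : R) :
  (lam (`[a, b]%classic : set (measurableTypeR R)) < +oo)%E.
Proof.
by rewrite lebesgue_measure_itv/=; case: ifP => _; rewrite -?EFinB ?ltry.
Qed.

End line_facts.

(** * Translates and correlations on R^n *)

Section rV_facts.
Variables (R : realType) (n : nat).
Let mu := lebesgue_rV R n.
Local Notation lam := (@lebesgue_measure R).
Implicit Types (p q f g psi : 'rV[R]_n -> R) (u v x : 'rV[R]_n).

Lemma integral_shift_rV (F : 'rV[R]_n -> \bar R) v : measurable_fun setT F ->
  (\int[mu]_x F (x + v)%R = \int[mu]_x F x)%E.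
Proof.
exact: (integral_preserving (@measurable_shift_rV R n v)
  (@lebesgue_rV_shift R n v)).
Qed.

Lemma square_integrable_shift f v :
  square_integrable mu f -> square_integrable mu (fun x => f (x + v)).
Proof.
move=> [mf lf]; split.
  by apply: measurableT_comp => //; exact: measurable_shift_rV.
rewrite (integral_shift_rV (F := fun x => (f x ^+ 2)%:E))//.
by apply/measurable_EFinP; exact: measurable_funX.
Qed.

Lemma square_integrable_cube k : square_integrable mu \1_(@cube R n k).
Proof.
apply: square_integrable_indic; first exact: measurable_open_box.
exact: lebesgue_rV_open_box_lty.
Qed.

Lemma flat_test_measurable psi : flat_test psi -> measurable_fun setT psi.
Proof. by move=> [e _]; exact: flat_algebra_measurable. Qed.

Lemma flat_test_square_integrable psi : flat_test psi -> square_integrable mu psi.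
Proof.
move=> [epsi [M psiM]]; have [C HC] := flat_algebra_bounded epsi.
have := square_integrable_scale C (square_integrable_cube (Num.Def.truncn M).+1).
apply: le_square_integrable; first exact: flat_algebra_measurable.
move=> x; have C0 : 0 <= C := le_trans (normr_ge0 _) (HC x).
rewrite indicE; have [xk|/negP xk] := boolP (x \in _).
  by rewrite mulr1 (le_trans (HC _))// ler_norm.
rewrite psiM ?normr0//; apply: contrapT => nx; apply: xk; rewrite inE => i.
rewrite -ltr_norml (le_lt_trans _ (truncnS_gt _))//.
by rewrite leNgt; apply/negP => Mx; apply: nx; exists i.
Qed.

Lemma derive_shift_rV psi u v x :
  'D_u (fun y => psi (y + v)) x = 'D_u psi (x + v).
Proof.
rewrite /derive (_ : (fun h : R => _) = (fun h : R => h^-1 *: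
    ((psi \o shift (x + v)) (h *: u) - psi (x + v))))//.
by apply/funext => h /=; rewrite addrA.
Qed.

Lemma flat_test_sum (a : 'I_n -> R) (D : 'I_n -> 'rV[R]_n -> R) :
  (forall i, flat_test (D i)) -> flat_test (fun x => \sum_i a i * D i x).
Proof.
move=> tD; elim: (index_enum _) => [|i s [es [M sM]]].
  rewrite (_ : (fun x => _) = fun=> 0).
    by split; [exact: flat_alg_cst|exists 0].
  by apply/funext => x; rewrite big_nil.
rewrite (_ : (fun x => _) = fun x => a i * D i x + \sum_(j <- s) a j * D j x).
  have [eD [N DN]] := tD i; split.
    apply: flat_alg_add => //; apply: flat_alg_mul => //; exact: flat_alg_cst.
  exists (Num.max M N) => x [j]; rewrite gt_max => /andP[Mx Nx].
  by rewrite sM ?DN ?mulr0 ?addr0//; exists j.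
by apply/funext => x; rewrite big_cons.
Qed.

Lemma flat_test_derive_dir psi u : flat_test psi ->
  [/\ flat_test ('D_u psi), (forall x, is_derive x u psi ('D_u psi x)) &
      'D_(- u) psi = fun x => - 'D_u psi x].
Proof.
move=> tpsi; have [D [tD _ HD]] := flat_test_derive tpsi.
have E w x : 'D_w psi x = \sum_i w ord0 i * D i x.
  exact: (@derive_val _ _ _ _ _ _ _ (HD x w)).
split.
- rewrite (_ : 'D_u psi = fun x => \sum_i u ord0 i * D i x).
    exact: flat_test_sum.
  by apply/funext => x; exact: E.
- by move=> x; rewrite E; exact: HD.
- apply/funext => x; rewrite !E -sumrN; apply: eq_bigr => i _.
  by rewrite mxE mulNr.
Qed.

Lemma measurable_line v : measurable_fun setT
  (fun z : 'rV[R]_n * measurableTypeR R => z.1 + (z.2 : R) *: v).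
Proof.
apply: measurable_fun_rV => i.
rewrite (_ : _ \o _ = fun z => rV_coord i z.1 + z.2 * v ord0 i); last first.
  by apply/funext => z; rewrite /rV_coord /= !mxE.
apply: measurable_funD; last exact: measurable_funM.
by apply: measurableT_comp => //; exact: measurable_rV_coord.
Qed.

(** For each [r], |p(x) q(x + r v)| <= p(x)^2 + q(x + r v)^2, and by translation invariance the
    right side has the integral [K], the same for all [r]; then [D] has finite measure. This
    justifies the exchanges of the integral over R^n with the one along a line. *)
Lemma integrable_correlation p q v (D : set (measurableTypeR R)) :
  square_integrable mu p -> square_integrable mu q ->
  measurable D -> (lam D < +oo)%E ->
  (mu \x lam)%E.-integrable setT
    (fun z => (\1_D z.2 * (p z.1 * q (z.1 + z.2 *: v)))%:E).
Proof.
move=> sp sq mD Doo; have [mp ip] := sp; have [mq iq] := sq.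
set F := (F in integrable _ _ F).
have mf : measurable_fun setT F.
  apply/measurable_EFinP; apply: measurable_funM.
    by apply: measurableT_comp => //; exact: measurable_indic.
  apply: measurable_funM; first exact: measurableT_comp.
  by apply: measurableT_comp => //; exact: measurable_line.
apply: (@integrable21ltyP _ _ _ _ _ mu lam F mf).2.
pose K := (\int[mu]_x (p x ^+ 2)%:E + \int[mu]_x (q x ^+ 2)%:E)%E.
have K0 : (0 <= K)%E by apply: adde_ge0; apply: integral_ge0 => x _;
  rewrite lee_fin sqr_ge0.
apply: (@le_lt_trans _ _ (\int[lam]_r (K * (\1_D r)%:E))%E).
  apply: ge0_le_integral => //.
  - by move=> r _; exact: integral_ge0.
  - apply: (@measurable_fun_fubini_tonelli_G _ _ _ _ _ mu (abse \o F)).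
      exact: measurableT_comp.
    by move=> z; exact: abse_ge0.
  - apply: emeasurable_funM; first exact: measurable_cst.
    by apply/measurable_EFinP; exact: measurable_indic.
  move=> r _; have [mqs iqs] := square_integrable_shift (r *: v) sq.
  apply: (@le_trans _ _ (\int[mu]_x
      ((\1_D r)%:E * ((p x ^+ 2)%:E + (q (x + r *: v) ^+ 2)%:E)))%E).
    apply: ge0_le_integral => //.
    + exact: measurableT_comp (measurable_fun_pair1 r mf).
    + apply/measurable_EFinP; apply: measurable_funM => //.
      by apply: measurable_funD; apply: measurable_funX.
    + move=> x _; rewrite -EFinD -EFinM/= lee_fin normrM.
      by rewrite (ger0_norm (x := \1_D r))// ler_wpM2l// normM_le_sqD.
  have m1 : measurable_fun setT (fun x => (p x ^+ 2)%:E).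
    by apply/measurable_EFinP; exact: measurable_funX.
  have m2 : measurable_fun setT (fun x => (q (x + r *: v) ^+ 2)%:E).
    by apply/measurable_EFinP; exact: measurable_funX.
  rewrite ge0_integralZl//; last 2 first.
  - exact: emeasurable_funD.
  - by move=> x _; rewrite adde_ge0// lee_fin sqr_ge0.
  rewrite ge0_integralD//; [|by move=> x _; rewrite lee_fin sqr_ge0..].
  rewrite (integral_shift_rV (F := fun x => (q x ^+ 2)%:E)); last first.
    by apply/measurable_EFinP; exact: measurable_funX.
  by rewrite muleC.
rewrite ge0_integralZl//; last first.
  by apply/measurable_EFinP; exact: measurable_indic.
rewrite integral_indic// setIT lte_mul_pinfty// ge0_fin_numE//.
by rewrite /K lte_add_pinfty.
Qed.

End rV_facts.

Lemma ae_eq_integrable d (T : measurableType d) (R : realType)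
    (mu : {measure set T -> \bar R}) (f g : T -> \bar R) :
  measurable_fun setT g -> {ae mu, forall x, f x = g x} ->
  mu.-integrable setT f -> mu.-integrable setT g.
Proof.
move=> mg fg /integrableP[mf fi]; apply/integrableP; split => //.
rewrite (ae_eq_integral (abse \o f)) => //.
- exact: measurableT_comp.
- exact: measurableT_comp.
- by apply: filterS fg => x fgx _ /=; rewrite fgx.
Qed.

Lemma ae_eq_integralT d (T : measurableType d) (R : realType)
    (mu : {measure set T -> \bar R}) (f g : T -> \bar R) :
  measurable_fun setT f -> measurable_fun setT g ->
  {ae mu, forall x, f x = g x} -> (\int[mu]_x f x = \int[mu]_x g x)%E.
Proof.
move=> mf mg fg; apply: ae_eq_integral => //.
by apply: filterS fg => x fgx _ /=; rewrite fgx.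
Qed.

Lemma integrable_itv_mul (R : realType) (a b : R) (f : measurableTypeR R -> R) C :
  measurable_fun setT f -> (forall r, `|f r| <= C) ->
  (@lebesgue_measure R).-integrable setT
    (fun r : measurableTypeR R => (\1_(`[a, b]%classic) r * f r)%:E).
Proof.
move=> mf fC.
apply: (@le_integrable _ _ _ lebesgue_measure _ measurableT _
    (fun r => C%:E * (\1_(`[a, b]%classic) r)%:E)%E).
- apply/measurable_EFinP; apply: measurable_funM => //.
- move=> r _ /=; rewrite lee_fin mulrC !normrM ler_wpM2r//.
  by rewrite (le_trans (fC r))// ler_norm.
- by apply: integrableZl => //; exact: integrable_indic_itv.
Qed.

(** * Absolute continuity along lines *)

Section line_integral.
Variables (R : realType) (n : nat) (u : 'rV[R]_n) (g : 'rV[R]_n -> R).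
Let mu := lebesgue_rV R n.
Local Notation lam := (@lebesgue_measure R).
Hypothesis sg : square_integrable mu g.

Definition line_integrand (a t : R) (x : 'rV[R]_n) (r : R) : R :=
  \1_(`[a, t]%classic) r * g (x + r *: u).

(** [fine] sends an infinite integral to 0; by [ae_integrable_line_integrand] this concerns only a
    null set of [x]. *)
Definition line_integral (a t : R) (x : 'rV[R]_n) : R :=
  fine (\int[lam]_r (line_integrand a t x r)%:E).

Lemma measurable_line_integrand a t : measurable_fun setT
  (fun z : 'rV[R]_n * measurableTypeR R => line_integrand a t z.1 z.2).
Proof.
have [mg _] := sg; apply: measurable_funM.
  by apply: measurableT_comp => //; apply: measurable_indic; exact: measurable_itv.
by apply: measurableT_comp => //; exact: measurable_line.
Qed.

Lemma measurable_line_integral a t : measurable_fun setT (line_integral a t).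
Proof.
have mL : measurable_fun setT (fun z : 'rV[R]_n * measurableTypeR R =>
    (line_integrand a t z.1 z.2)%:E).
  by apply/measurable_EFinP; exact: measurable_line_integrand.
by apply: measurableT_comp => //; exact: (measurable_section_integral lam mL).
Qed.

(** The indicator of a cube is square integrable, so [integrable_correlation] applies with it as
    [p]; on the cube that weight is 1, and countably many cubes cover the space. *)
Lemma ae_integrable_line_integrand a t :
  {ae mu, forall x, lam.-integrable setT (EFin \o line_integrand a t x)}.
Proof.
have H k : {ae mu, forall x, @cube R n k x ->
    lam.-integrable setT (EFin \o line_integrand a t x)}.
  have := @ae_integrable1 _ _ _ _ _ mu lam _
    (@integrable_correlation R n _ _ u _ (square_integrable_cube R n k) sg
      (measurable_itv `[a, t]) (lebesgue_itv_lty a t)).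
  apply: filterS => x + xk; apply: eq_integrable => // r _ /=.
  by rewrite /line_integrand (_ : \1_(@cube R n k) x = 1) ?mul1r// indicE mem_set.
apply: filterS (ae_foralln H) => x Hx.
have [k _ xk] : (\bigcup_k @cube R n k) x by rewrite bigcup_cube.
exact: Hx xk.
Qed.

(** For almost every [x] the line integral converges, and [p x] can be moved inside it; the double
    integral so obtained is one to which Fubini applies. *)
Lemma line_integral_mul (p : 'rV[R]_n -> R) a t : square_integrable mu p ->
  mu.-integrable setT (fun x => (p x * line_integral a t x)%:E) /\
  (\int[mu]_x (p x * line_integral a t x)%:E =
   \int[mu]_x \int[lam]_r
     (\1_(`[a, t]%classic) r * (p x * g (x + r *: u)))%:E)%E.
Proof.
move=> sp; have [mp _] := sp.
have iC := @integrable_correlation R n _ _ u _ sp sg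
  (measurable_itv `[a, t]) (lebesgue_itv_lty a t).
have mpl : measurable_fun setT (fun x => (p x * line_integral a t x)%:E).
  apply/measurable_EFinP; apply: measurable_funM => //.
  exact: measurable_line_integral.
have E : {ae mu, forall x, (\int[lam]_r
     (\1_(`[a, t]%classic) r * (p x * g (x + r *: u)))%:E)%E
     = (p x * line_integral a t x)%:E}.
  apply: filterS (ae_integrable_line_integrand a t) => x ix.
  rewrite EFinM fineK; last exact: integrable_fin_num.
  rewrite -integralZl//; apply: eq_integral => r _.
  by rewrite -EFinM /line_integrand mulrCA.
have iF := integrable_fubini_F iC.
split; first exact: ae_eq_integrable E iF.
apply/esym/ae_eq_integralT => //.
by have /integrableP[] := iF.
Qed.

End line_integral.

Section absolute_continuity.
Variables (R : realType) (n : nat) (u : 'rV[R]_n) (phi g : 'rV[R]_n -> R).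
Let mu := lebesgue_rV R n.
Local Notation lam := (@lebesgue_measure R).
Hypothesis sphi : square_integrable mu phi.
Hypothesis sg : square_integrable mu g.
Hypothesis weak : forall psi, flat_test psi ->
  (\int[mu]_x (phi x * 'D_u psi x)%:E = - \int[mu]_x (g x * psi x)%:E)%E.

(* The fundamental theorem of calculus writes the increment of [psi] as the
   integral of its directional derivatives; by Fubini the weak derivative is
   tested against the translates of [psi]. *)
Lemma increment_test psi a t : flat_test psi -> a < t ->
  (\int[mu]_x (phi x * (psi (x + t *: - u) - psi (x + a *: - u)))%:E =
   \int[mu]_x (psi x * line_integral u g a t x)%:E)%E.
Proof.
move=> tpsi at_; have [tD dpsi DN] := flat_test_derive_dir u tpsi.
have [tDN dpsiN _] := flat_test_derive_dir (- u) tpsi.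
have mI := measurable_itv `[a, t] : measurable (_ : set (measurableTypeR R)).
have Ioo := lebesgue_itv_lty a t.
have spsi := flat_test_square_integrable tpsi.
have sDN := flat_test_square_integrable tDN.
have FTC x : (\int[lam]_r (\1_(`[a, t]%classic) r * 'D_(- u) psi (x + r *: - u))%:E
    = (psi (x + t *: - u) - psi (x + a *: - u))%:E)%E.
  have dF (r : R) : is_derive r 1 (fun s : R => psi (s *: (- u) + x))
      ('D_(- u) psi (r *: (- u) + x)).
    by apply/is_derive_along; exact: dpsiN.
  have cf : continuous (fun s : R => 'D_(- u) psi (s *: (- u) + x)).
    have [_ dd _] := flat_test_derive_dir (- u) tDN.
    apply: (is_derive_continuous
      (f := fun s : R => 'D_(- u) ('D_(- u) psi) (s *: (- u) + x))) => r.
    by apply/is_derive_along; exact: dd.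
  rewrite !(addrC x) -(integral_derivative dF cf (ltW at_)).
  by apply: eq_integral => r _; rewrite (addrC x).
rewrite (line_integral_mul u sg a t spsi).2.
transitivity (\int[mu]_x \int[lam]_r (\1_(`[a, t]%classic) r
    * (phi x * 'D_(- u) psi (x + r *: - u)))%:E)%E.
  apply: eq_integral => x _; rewrite EFinM -FTC -integralZl//.
    by apply: eq_integral => r _; rewrite -EFinM mulrCA.
  have [eDN _] := tDN; have [C HC] := flat_algebra_bounded eDN.
  apply: (@integrable_itv_mul R a t (fun r => 'D_(- u) psi (x + r *: - u)) C) => //.
  exact: measurable_fun_pair2 (measurableT_comp (flat_test_measurable tDN)
    (@measurable_line R n (- u))).
rewrite (Fubini (integrable_correlation (- u) sphi sDN mI Ioo)).
rewrite (Fubini (integrable_correlation u spsi sg mI Ioo)).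
apply: eq_integral => r _ /=.
have tpr := flat_test_shift (r *: - u) tpsi.
have spr := flat_test_square_integrable tpr.
have [tDr _ _] := flat_test_derive_dir u tpr.
have sDr := flat_test_square_integrable tDr.
(* At fixed [r], the derivative along [- u] is minus the derivative along [u] of a translate of
   [psi], which is itself a test function: [weak] applies to it. *)
transitivity (\int[mu]_x ((- \1_(`[a, t]%classic) r)%:E *
    (phi x * 'D_u (fun y => psi (y + r *: - u)) x)%:E))%E.
  apply: eq_integral => x _; rewrite -EFinM derive_shift_rV (congr1 (@^~ _) DN).
  by rewrite mulNr !mulrN.
rewrite integralZl//; last exact: square_integrable_mul.
rewrite (weak tpr) EFinN muleNN -integralZl//; last exact: square_integrable_mul.
(* The translation by [r u] moves the shift from [psi] to [g]. *)
rewrite -(integral_shift_rV (r *: u)); last first.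
  apply/measurable_EFinP/measurable_funM => //; apply: measurable_funM.
    by case: sg.
  by case: spr.
apply: eq_integral => x _ /=.
by rewrite -EFinM scalerN addrK (mulrC (g _)).
Qed.

End absolute_continuity.

Section absolute_continuity.
Variables (R : realType) (n : nat) (u : 'rV[R]_n) (phi g : 'rV[R]_n -> R).
Let mu := lebesgue_rV R n.
Local Notation lam := (@lebesgue_measure R).
Hypothesis sphi : square_integrable mu phi.
Hypothesis sg : square_integrable mu g.
Hypothesis weak : forall psi, flat_test psi ->
  (\int[mu]_x (phi x * 'D_u psi x)%:E = - \int[mu]_x (g x * psi x)%:E)%E.


(** The difference [w] of the two sides is integrable on cubes. Tested against [psi], translation
    invariance moves the shifts from [phi] to [psi], and [increment_test] makes the result 0; the
    fundamental lemma concludes. *)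
Lemma ac_fixed a t : a < t -> {ae mu, forall x,
  phi (x + t *: u) = phi (x + a *: u) + line_integral u g a t x}.
Proof.
move=> at_.
have [mphi _] := sphi.
have st v := square_integrable_shift v sphi.
have ml := measurable_line_integral u sg a t.
pose w x := phi (x + t *: u) - phi (x + a *: u) - line_integral u g a t x.
have mw : measurable_fun setT w.
  apply: measurable_funB => //; apply: measurable_funB.
    by case: (st (t *: u)).
  by case: (st (a *: u)).
have iD p : square_integrable mu p ->
    mu.-integrable setT (fun x => (p x * phi (x + t *: u))%:E
       - (p x * phi (x + a *: u))%:E)%E.
  by move=> sp; apply: integrableB => //; exact: square_integrable_mul.
have iw p : square_integrable mu p ->
    mu.-integrable setT (fun x => (p x * w x)%:E).
  move=> sp; rewrite (_ : (fun x => _) = (fun x => (p x * phi (x + t *: u))%:E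
       - (p x * phi (x + a *: u))%:E - (p x * line_integral u g a t x)%:E)%E).
    by apply: integrableB => //; [exact: iD|exact: (line_integral_mul u sg a t sp).1].
  by apply/funext => x; rewrite -!EFinB -!mulrBr.
suff H : {ae mu, forall x, w x = 0}.
  apply: filterS H => x /eqP; rewrite /w subr_eq0 => /eqP <-.
  by rewrite [RHS]addrC subrK.
apply: (fundamental_lemma mw).
- move=> k; apply/(integrable_mkcond _ (measurable_open_box _ _)).
  apply: eq_integrable (iw _ (square_integrable_cube R n k)) => // x _.
  rewrite patchE indicE; case: (_ \in _); first by rewrite mul1r.
  by rewrite mul0r.
- move=> psi tpsi; have spsi := flat_test_square_integrable tpsi.
  rewrite (eq_integral (fun x => (psi x * phi (x + t *: u))%:E
       - (psi x * phi (x + a *: u))%:E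
       - (psi x * line_integral u g a t x)%:E)%E); last first.
    by move=> x _; rewrite -!EFinB -!mulrBr mulrC.
  rewrite integralB//; [|exact: iD|exact: (line_integral_mul u sg a t spsi).1].
  rewrite integralB//; [|exact: square_integrable_mul..].
  have sh r : (\int[mu]_x (psi x * phi (x + r *: u))%:E =
      \int[mu]_x (phi x * psi (x + r *: - u))%:E)%E.
    rewrite -[RHS](integral_shift_rV (r *: u)).
      by apply: eq_integral => x _; rewrite scalerN addrK mulrC.
    apply/measurable_EFinP/measurable_funM => //.
    by have [] := square_integrable_shift (r *: - u) spsi.
  rewrite !sh -integralB//; last 2 first.
  + by apply: square_integrable_mul => //; exact: square_integrable_shift.
  + by apply: square_integrable_mul => //; exact: square_integrable_shift.
  rewrite -(increment_test sphi sg weak tpsi at_).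
  under eq_integral => x _ do rewrite -EFinB -mulrBr.
  rewrite subee//; apply: integrable_fin_num => //.
  under eq_fun => x do rewrite mulrBr EFinB.
  by apply: integrableB => //; apply: square_integrable_mul => //;
    exact: square_integrable_shift.
Qed.

(** Joint measurability in the base point and the upper endpoint, which [ae_exchange] demands. The
    indicator of [[a, t]] is read as a measurable condition on the pair formed by the endpoint and
    the integration variable. *)
Lemma measurable_line_integral2 a : measurable_fun setT
  (fun z : 'rV[R]_n * measurableTypeR R => line_integral u g a z.2 z.1).
Proof.
have [mg _] := sg.
have mL : measurable_fun setT
    (fun y : ('rV[R]_n * measurableTypeR R) * measurableTypeR R =>
      (line_integrand u g a y.1.2 y.1.1 y.2)%:E).
  apply/measurable_EFinP; rewrite /line_integrand.
  rewrite (_ : (fun y => _) =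
      (fun y : ('rV[R]_n * measurableTypeR R) * measurableTypeR R =>
       if (a <= y.2) && (y.2 <= y.1.2) then g (y.1.1 + y.2 *: u) else 0)).
    apply: measurable_fun_ifT => //.
      apply: measurable_and; apply: measurable_fun_ler => //.
      exact: measurableT_comp.
    apply: measurableT_comp => //.
    have mp : measurable_fun setT
        (fun y : ('rV[R]_n * measurableTypeR R) * measurableTypeR R => (y.1.1, y.2)).
      by apply: measurable_fun_pair => //; exact: measurableT_comp.
    exact: (measurableT_comp (@measurable_line R n u) mp).
  apply/funext => y; rewrite indicE mem_setE in_itv/=.
  by case: ifP => _; rewrite ?mul1r ?mul0r.
by apply: measurableT_comp => //; exact: (measurable_section_integral lam mL).
Qed.

(** The left endpoints are integers so that the union over [k] of the exceptional sets is null; they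
    still reach to the left of any compact support. *)
Lemma absolutely_continuous_on_lines : {ae mu, forall x, forall k : nat,
  {ae lam, forall t : measurableTypeR R, - k%:R < t ->
     phi (x + t *: u) = phi (x + (- k%:R) *: u) + line_integral u g (- k%:R) t x}}.
Proof.
apply: ae_foralln => k; have [mphi _] := sphi.
apply: (@ae_exchange _ _ _ _ R mu lam (fun x (t : measurableTypeR R) => - k%:R < t ->
  phi (x + t *: u) = phi (x + (- k%:R) *: u) + line_integral u g (- k%:R) t x)).
(* The exceptional set is where [h] is nonzero; the default value 0 encodes the premise
   [- k%:R < t]. *)
- pose h (z : 'rV[R]_n * measurableTypeR R) : R := if - k%:R < z.2 then
    phi (z.1 + z.2 *: u) - (phi (z.1 + (- k%:R) *: u)
      + line_integral u g (- k%:R) z.2 z.1) else 0.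
  rewrite (_ : [set z | _] = h @^-1` (~` [set 0])); last first.
    apply/seteqP; split => z /=; rewrite /h.
      by move=> /not_implyP[-> /eqP]; rewrite -subr_eq0 => /eqP.
    case: ifPn => // kz hz H; apply: hz; apply/eqP; rewrite subr_eq0; apply/eqP.
    exact: H.
  rewrite -[X in measurable X]setTI.
  suff mh : measurable_fun setT h.
    by apply: mh => //; apply: measurableC; exact: measurable_set1.
  apply: measurable_fun_ifT => //.
    exact: measurable_fun_ltr.
  apply: measurable_funB; first by apply: measurableT_comp => //; exact: measurable_line.
  apply: measurable_funD; last exact: measurable_line_integral2.
  have [ms _] := square_integrable_shift (- k%:R *: u) sphi.
  exact: (measurableT_comp ms measurable_fst).
- move=> t; have [kt|kt] := ltP (- k%:R) t.
    by apply: filterS (ac_fixed kt) => x ->.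
  by apply: aeW => x.
Qed.

End absolute_continuity.

(** * Weak derivatives on the line *)

Lemma integrable_tensor d1 d2 (T1 : measurableType d1) (T2 : measurableType d2)
    (R : realType) (m1 : {sigma_finite_measure set T1 -> \bar R})
    (m2 : {sigma_finite_measure set T2 -> \bar R}) (f : T1 -> R) (g : T2 -> R) :
  m1.-integrable setT (EFin \o f) -> m2.-integrable setT (EFin \o g) ->
  (m1 \x m2)%E.-integrable setT (fun z => (f z.1 * g z.2)%:E).
Proof.
move=> /integrableP[/measurable_EFinP mf If] /integrableP[/measurable_EFinP mg Ig].
have mfg : measurable_fun setT (fun z : T1 * T2 => (f z.1 * g z.2)%:E).
  apply/measurable_EFinP; apply: measurable_funM.
    exact: measurableT_comp mf measurable_fst.
  exact: measurableT_comp mg measurable_snd.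
apply: (@integrable12ltyP _ _ _ _ _ m1 m2 _ mfg).2.
have mgn : measurable_fun setT (fun y => `|(g y)%:E|%E).
  by apply: measurableT_comp => //; exact/measurable_EFinP.
rewrite (eq_integral (fun x => (\int[m2]_y `|(g y)%:E|) * `|(f x)%:E|)%E).
  rewrite ge0_integralZl//; last 2 first.
  - by apply: measurableT_comp => //; exact/measurable_EFinP.
  - exact: integral_ge0.
  rewrite lte_mul_pinfty//; first exact: integral_ge0.
  by rewrite ge0_fin_numE//; exact: integral_ge0.
move=> x _; rewrite muleC -ge0_integralZl//.
by apply: eq_integral => y _; rewrite -abseM EFinM.
Qed.

Section slice.
Variable R : realType.
Local Notation lam := (@lebesgue_measure R).

(** Exactly what integration by parts against a primitive uses. The pairs coming from smooth test
    functions on ['rV[R]_1] are of this kind ([test_function_C1_test]). *)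
Definition C1_test (b b' : R -> R) := [/\ forall r : R, is_derive r 1 b (b' r),
  continuous b' & exists M : R, forall r, M < `|r| -> b r = 0].

Lemma C1_test_shift b b' s : C1_test b b' ->
  C1_test (fun r => b (r + s)) (fun r => b' (r + s)).
Proof.
move=> [db cb [M bM]]; split.
- move=> r; have d1 : is_derive r 1 (fun x : R => x + s) 1.
    by apply: (is_derive_eq (is_deriveD (is_derive_id r 1) (is_derive_cst s r 1)));
      rewrite addr0.
  have := @is_derive1_comp _ b (fun x => x + s) r _ _ (db (r + s)) d1.
  by rewrite mulr1.
- move=> r; apply: continuous_comp; last exact: cb.
  by apply: continuousD; [exact: cvg_id|exact: cst_continuous].
- exists (M + `|s|) => r Mr; apply: bM; rewrite -(ltrD2r `|s|).
  rewrite (lt_le_trans Mr)// -[X in `|X| <= _](addrK s).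
  by rewrite -(normrN s) ler_normD.
Qed.

(** The bound on the support is an integer so that [- k%:R] is one of the left endpoints of the
    primitive formula; vanishing holds at the endpoints too. Boundedness comes from compactness of
    [[-k, k]]. *)
Lemma C1_test_bound b b' : C1_test b b' -> exists k : nat,
  [/\ forall r, k%:R <= `|r| -> b r = 0, forall r, k%:R <= `|r| -> b' r = 0,
      exists C, forall r, `|b r| <= C & exists C, forall r, `|b' r| <= C].
Proof.
move=> [db cb' [M bM]]; exists (Num.Def.truncn M).+1.
have bz r : (Num.Def.truncn M).+1%:R <= `|r| -> b r = 0.
  by move=> kr; apply: bM; rewrite (lt_le_trans (truncnS_gt _)).
have bz' r : (Num.Def.truncn M).+1%:R <= `|r| -> b' r = 0.
  move=> kr; rewrite -(@derive_val _ _ _ _ _ _ _ (db r)).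
  rewrite (@near_eq_derive _ _ _ _ (cst 0)) ?derive_cst//.
  have Mr : M < `|r| by rewrite (lt_le_trans (truncnS_gt _)).
  have := @norm_continuous _ R^o r.
  by move=> /cvgr_gt/(_ _ Mr); apply: filterS => y; exact: bM.
have bnd (h : R -> R) : continuous h ->
    (forall r, (Num.Def.truncn M).+1%:R <= `|r| -> h r = 0) ->
    exists C, forall r, `|h r| <= C.
  move=> ch hz; set k := _.+1%:R in hz.
  have cpt : compact (h @` `[- k, k]).
    by apply: continuous_compact; [exact: continuous_subspaceT|exact: segment_compact].
  have [C [_ HC]] := compact_bounded cpt.
  exists (`|C| + 1) => r; have [kr|rk] := leP k `|r|.
    by rewrite hz// normr0 addr_ge0.
  apply: HC; first by rewrite ltr_pwDr// ler_norm.
  by exists r => //=; rewrite in_itv/= -ler_norml ltW.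
split => //; apply: bnd => //; exact: is_derive_continuous db.
Qed.

Lemma C1_test_square_integrable b b' : C1_test b b' ->
  square_integrable lam b /\ square_integrable lam b'.
Proof.
move=> Cb; have [k [bz bz' [C bC] [C' bC']]] := C1_test_bound Cb.
have [db cb' _] := Cb.
have H (h : R -> R) D : continuous h -> (forall r, k%:R <= `|r| -> h r = 0) ->
    (forall r, `|h r| <= D) -> square_integrable lam h.
  move=> ch hz hD.
  apply: (@le_square_integrable _ _ _ _ _
    (fun r => D * \1_(`[- k%:R, k%:R]%classic : set (measurableTypeR R)) r)).
  - exact: continuous_measurable_R.
  - move=> r; rewrite indicE mem_setE in_itv/= -ler_norml.
    have [rk|kr] := leP `|r| k%:R; last by rewrite hz ?normr0// ltW.
    by rewrite mulr1 (le_trans (hD r))// ler_norm.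
  - apply/square_integrable_scale/square_integrable_indic => //.
    exact: lebesgue_itv_lty.
split; [apply: H bz bC|exact: H bz' bC'].
exact: is_derive_continuous db.
Qed.

(* The constant may depend on the left endpoint [-k]; for a given test function
   one endpoint to the left of its support is enough. *)
Lemma weak_derivative_of_primitive (f g b b' : R -> R) :
  square_integrable lam f -> square_integrable lam g ->
  (forall k : nat, exists C, {ae lam, forall t : measurableTypeR R, - k%:R < t ->
    f t = C + fine (\int[lam]_r (\1_(`[- k%:R, t]%classic) r * g r)%:E)}) ->
  C1_test b b' ->
  (\int[lam]_t (f t * b' t)%:E = - \int[lam]_t (g t * b t)%:E)%E.
Proof.
move=> sf sg ac Cb; have [k [bz bz' _ [B' bB']]] := C1_test_bound Cb.
have [db cb' _] := Cb; have [C acC] := ac k; have [mf _] := sf; have [mg _] := sg.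
set N := k%:R in acC bz bz'.
have N0 : 0 <= N by [].
pose I : set (measurableTypeR R) := `[- N, N]%classic.
have mI : measurable I by exact: measurable_itv.
have sI : square_integrable lam (\1_I : measurableTypeR R -> R).
  by apply: square_integrable_indic => //; exact: lebesgue_itv_lty.
have mb' : measurable_fun [set: measurableTypeR R] (b' : measurableTypeR R -> R).
  exact: continuous_measurable_R.
have ig : lam.-integrable setT (EFin \o (fun r => \1_I r * g r)).
  exact: square_integrable_mul.
have ib' : lam.-integrable setT (EFin \o (fun r => \1_I r * b' r)).
  exact: integrable_itv_mul mb' bB'.
have bI' t : b' t = \1_I t * b' t.
  rewrite indicE; have [_|/negP tI] := boolP (t \in _); first by rewrite mul1r.
  rewrite mul0r bz'// leNgt; apply/negP => tN; apply: tI.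
  by rewrite inE /I/= in_itv/= -ler_norml ltW.
have bI t : b t = \1_I t * b t.
  rewrite indicE; have [_|/negP tI] := boolP (t \in _); first by rewrite mul1r.
  rewrite mul0r bz// leNgt; apply/negP => tN; apply: tI.
  by rewrite inE /I/= in_itv/= -ler_norml ltW.
(* The kernel b'(t) g(r) on the triangle -N <= r <= t <= N. Integrated over r it gives b'(t) times
   the primitive of g; integrated over t it gives g(r) (b(N) - b(r)) = - g(r) b(r). *)
pose G (z : measurableTypeR R * measurableTypeR R) : R :=
  if z.2 <= z.1 then (\1_I z.1 * b' z.1) * (\1_I z.2 * g z.2) else 0.
have iG : (lam \x lam)%E.-integrable setT (EFin \o G).
  have iT := integrable_tensor ib' ig.
  have /integrableP[/measurable_EFinP mT _] := iT.
  apply: le_integrable iT => //.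
    apply/measurable_EFinP; apply: measurable_fun_ifT => //.
    exact: measurable_fun_ler.
  by move=> z _; rewrite /= /G lee_fin; case: ifP => //; rewrite normr0.
have inner1 t : - N < t -> ((\1_I t * b' t) * fine
    (\int[lam]_r (\1_(`[- N, t]%classic) r * g r)%:E))%:E =
    (\int[lam]_r (G (t, r))%:E)%E.
  move=> Nt.
  have it : lam.-integrable setT (fun r => (\1_(`[- N, t]%classic) r * g r)%:E).
    apply: square_integrable_mul => //; apply: square_integrable_indic => //.
    exact: lebesgue_itv_lty.
  rewrite EFinM fineK; last exact: integrable_fin_num.
  rewrite -integralZl//; apply: eq_integral => r _; rewrite -EFinM; congr EFin.
  rewrite /G/= !indicE !mem_setE !in_itv/=.
  have [rt|tr] := leP r t; last by rewrite andbF mul0r mulr0.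
  rewrite andbT; have [tN|Nt'] := leP t N; last by rewrite andbF !mul0r.
  by rewrite (ltW Nt) (le_trans rt tN) !andbT.
have inner2 r : (\int[lam]_t (G (t, r))%:E = (- (g r * b r))%:E)%E.
  have [rI|/negP rI] := boolP (r \in I); last first.
    rewrite [b r]bI (_ : \1_I r = 0); last by rewrite indicE (negbTE (introN idP rI)).
    rewrite mul0r mulr0 oppr0 integral0_eq// => t _.
    rewrite /G/= (_ : \1_I r = 0); last by rewrite indicE (negbTE (introN idP rI)).
    by rewrite mul0r mulr0 if_same.
  have /andP[Nr rN] : - N <= r <= N by move: rI; rewrite inE /I/= in_itv.
  transitivity (\int[lam]_t ((g r)%:E * (\1_(`[r, N]%classic) t * b' t)%:E))%E.
    apply: eq_integral => t _; rewrite -EFinM; congr EFin.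
    rewrite /G/= !indicE !mem_setE !in_itv/= Nr rN/=.
    have [rt|tr] := leP r t; last by rewrite !mul0r mulr0.
    by rewrite (le_trans Nr rt)/= mul1r mulrC.
  rewrite integralZl//; last exact: integrable_itv_mul mb' bB'.
  by rewrite (integral_derivative db cb' rN) (bz N) ?ger0_norm// sub0r -EFinM mulrN.
transitivity (\int[lam]_t ((C * (\1_I t * b' t))%:E + \int[lam]_r (G (t, r))%:E))%E.
  apply: ae_eq_integralT.
  - by apply/measurable_EFinP; exact: measurable_funM.
  - apply: emeasurable_funD.
      by apply/measurable_EFinP; apply: measurable_funM => //; exact: measurable_funM.
    have /integrableP[mG _] := iG.
    exact: (measurable_section_integral lam mG).
  apply: filterS acC => t Ht; have [Nt|tN] := ltP (- N) t.
    rewrite -inner1// -EFinD; congr EFin.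
    by rewrite {1}bI' Ht//; ring.
  (* The formula for [f] says nothing when [t <= - N], but [b'] vanishes there. *)
  have Nnt : N <= `|t|.
    by rewrite ler0_norm; [rewrite lerNr|rewrite (le_trans tN) ?oppr_le0].
  have bt0 := bz' _ Nnt.
  rewrite bt0 !mulr0 add0e integral0_eq// => r _.
  by rewrite /G/= bt0 mulr0 mul0r if_same.
rewrite integralD//; last 2 first.
- under eq_fun => t do rewrite EFinM.
  exact: integrableZl.
- exact: (integrable_fubini_F iG).
under eq_integral => t _ do rewrite EFinM.
(* The constant contributes C (b(N) - b(-N)) = 0. *)
rewrite integralZl// (integral_derivative db cb'); last by rewrite ge0_cp.
rewrite !bz ?subrr ?mule0 ?add0e; last 2 first.
- by rewrite normrN ger0_norm.
- by rewrite ger0_norm.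
rewrite (Fubini iG).
under eq_integral => r _ do rewrite inner2 -mulN1r EFinM.
rewrite integralZl ?EFinN ?mulN1e//.
apply: square_integrable_mul => //.
by have [] := C1_test_square_integrable Cb.
Qed.

End slice.

(** * The one-dimensional inequality *)

Section line_as_rV1.
Variable R : realType.
Local Notation lam := (@lebesgue_measure R).
Let e : 'rV[R]_1 := delta_mx ord0 ord0.

(** Slices are functions of a real number, whereas the one-dimensional [lambda] lives on row vectors
    of length 1; this map is the dictionary between the two. *)
Definition line_rV1 (t : measurableTypeR R) : 'rV[R]_1 := (t : R) *: e.

Lemma line_rV1E t : line_rV1 t ord0 ord0 = t.
Proof. by rewrite /line_rV1 /e !mxE eqxx mulr1. Qed.

Lemma line_rV1K (x : 'rV[R]_1) : line_rV1 (x ord0 ord0) = x.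
Proof.
by apply/rowP => i; rewrite (ord1 i) line_rV1E.
Qed.

Lemma measurable_line_rV1 : measurable_fun setT line_rV1.
Proof.
apply: measurable_fun_rV => i; rewrite (_ : _ \o _ = id)//.
by apply/funext => t; rewrite /rV_coord/= (ord1 i) line_rV1E.
Qed.

Lemma lebesgue_line_rV1 A : measurable A -> lam (line_rV1 @^-1` A) = lebesgue_rV R 1 A.
Proof.
move=> mA.
have E a b : line_rV1 @^-1` (@open_box R 1 a b) = `]a ord0, b ord0[%classic.
  apply/seteqP; split => t /=; rewrite in_itv/=.
    by move=> /(_ ord0); rewrite line_rV1E.
  by move=> H i; rewrite (ord1 i) line_rV1E.
have := @measure_unique _ R _ _ (@cube R 1) (@measurable_open_boxes R 1)
  (@setI_closed_open_boxes R 1) _ (@bigcup_cube R 1)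
  (measure_function_pushforward__canonical__measure_function_Measure
    lam measurable_line_rV1) (lebesgue_rV R 1).
apply => //.
- by move=> k; exists (fun=> - k%:R), (fun=> k%:R).
- move=> _ [a [b ->]] /=; rewrite /pushforward E lebesgue_rV_open_box big_ord1.
  exact: lebesgue_measure_itvoo.
- by move=> k; rewrite /= /pushforward E lebesgue_measure_itvoo ltry.
Qed.

Lemma integral_rV1 (F : 'rV[R]_1 -> \bar R) : measurable_fun setT F ->
  (\int[lam]_t F (line_rV1 t) = \int[lebesgue_rV R 1]_x F x)%E.
Proof. exact: integral_preserving measurable_line_rV1 lebesgue_line_rV1 _. Qed.

Lemma measurable_head_rV1 : measurable_fun setT
  (fun x : 'rV[R]_1 => (x ord0 ord0 : measurableTypeR R)).
Proof. exact: (@measurable_rV_coord R 1 ord0). Qed.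

Lemma integral_head_rV1 (F : R -> R) :
  measurable_fun [set: measurableTypeR R] (F : measurableTypeR R -> R) ->
  (\int[lebesgue_rV R 1]_x (F (x ord0 ord0))%:E = \int[lam]_t (F t)%:E)%E.
Proof.
move=> mF; rewrite -integral_rV1; last first.
  by apply/measurable_EFinP; exact: measurableT_comp mF measurable_head_rV1.
by apply: eq_integral => t _; rewrite line_rV1E.
Qed.

Lemma test_function_C1_test (psi : 'rV[R]_1 -> R) : test_function psi ->
  C1_test (fun t => psi (line_rV1 t)) (fun t => partial ord0 psi (line_rV1 t)).
Proof.
move=> [spsi cpsi]; split.
- move=> t; have [_ /(_ ord0 (t *: e + 0)) dpsi] := spsi [::].
  have := derivableP dpsi; rewrite is_derive_along /line_rV1 addr0.
  rewrite (_ : (fun s : R => _) = (fun s : R => psi (s *: e)))//.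
  by apply/funext => s; rewrite addr0.
- have [cp _] := spsi [:: ord0] => t.
  apply: (@continuous_comp _ _ _ (fun t : R => t *: e)); last exact: cp.
  exact: scalel_continuous.
- have [M [_ HM]] := compact_bounded cpsi.
  exists (`|M| + 1) => t Mt; apply/eqP/negPn/negP => psit.
  have /HM : M < `|M| + 1 by rewrite ltr_pwDr// ler_norm.
  move=> /(_ (line_rV1 t)); rewrite /globally/=.
  move=> /(_ (@subset_closure _ [set x | psi x != 0] (line_rV1 t) psit)).
  apply/negP; rewrite -ltNge (lt_le_trans Mt)// -{1}(line_rV1E t).
  rewrite [leRHS]/Num.norm/= mx_normrE.
  by apply/bigmax_geP; right; exists (ord0, ord0).
Qed.

(** Every test function on ['rV[R]_1] is a [C1_test] pair when read on R, so the hypothesis on such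
    pairs contains the definition of the weak derivative. *)
Lemma H1_grad_line (f g : R -> R) :
  square_integrable lam f -> square_integrable lam g ->
  (forall b b', C1_test b b' ->
    (\int[lam]_t (f t * b' t)%:E = - \int[lam]_t (g t * b t)%:E)%E) ->
  H1_grad (fun x : 'rV[R]_1 => f (x ord0 ord0))
          (fun x : 'rV[R]_1 => const_mx (g (x ord0 ord0))).
Proof.
move=> sf sg fg.
have H (h : R -> R) : square_integrable lam h ->
    square_integrable (lebesgue_rV R 1) (fun x => h (x ord0 ord0)).
  move=> [mh ih]; split; first exact: measurableT_comp mh measurable_head_rV1.
  by rewrite (integral_head_rV1 (F := fun t => h t ^+ 2))//; exact: measurable_funX.
split; first by apply/Lfun2_square_integrable; exact: H.
move=> i; rewrite (ord1 i) (_ : (fun x => _) = fun x : 'rV[R]_1 => g (x ord0 ord0)).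
  split; first by apply/Lfun2_square_integrable; exact: H.
  move=> psi tpsi; have Cpsi := test_function_C1_test tpsi.
  have [db cb _] := Cpsi; have [mf _] := sf; have [mg _] := sg.
  have := fg _ _ Cpsi.
  rewrite -(integral_head_rV1 (F := fun t => f t * partial ord0 psi (line_rV1 t))).
    rewrite -(integral_head_rV1 (F := fun t => g t * psi (line_rV1 t))).
      under eq_integral => x _ do rewrite line_rV1K.
      by under [in RHS]eq_integral => x _ do rewrite line_rV1K.
    apply: measurable_funM => //; apply: continuous_measurable_R.
    exact: is_derive_continuous db.
  by apply: measurable_funM => //; exact: continuous_measurable_R.
by apply/funext => x; rewrite mxE.
Qed.

(* The shift by [K] makes both sides nonnegative, so that the inequality can be
   integrated over the slices by Tonelli. *)
Lemma line_bound (V : R -> R) (c L K : R) (f g : R -> R) :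
  continuous V -> (forall t, `|V t| <= K) -> 0 < c -> 0 <= c * L + K ->
  (lambda (fun y : 'rV[R]_1 => (c^-1 * V (y ord0 ord0))%R) <= L%:E)%E ->
  square_integrable lam f -> square_integrable lam g ->
  (forall b b', C1_test b b' ->
    (\int[lam]_t (f t * b' t)%:E = - \int[lam]_t (g t * b t)%:E)%E) ->
  (\int[lam]_t ((V t + K) * f t ^+ 2)%:E <=
   (4 * c)%:E * \int[lam]_t (g t ^+ 2)%:E
   + (c * L + K)%:E * \int[lam]_t (f t ^+ 2)%:E)%E.
Proof.
move=> cV VK c0 cLK lamL sf sg fg.
have [mf _] := sf; have [mg _] := sg.
have if2 := square_integrable_sqr sf; have ig2 := square_integrable_sqr sg.
have mV := continuous_measurable_R cV.
have mf2 : measurable_fun [set: measurableTypeR R] (fun t => f t ^+ 2).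
  exact: measurable_funX.
have mg2 : measurable_fun [set: measurableTypeR R] (fun t => g t ^+ 2).
  exact: measurable_funX.
have iVf : lam.-integrable setT (fun t => (V t * f t ^+ 2)%:E).
  apply: (@le_integrable _ _ _ lam _ measurableT _ (fun t => K%:E * (f t ^+ 2)%:E)%E).
  - by apply/measurable_EFinP; exact: measurable_funM.
  - move=> t _; rewrite /= lee_fin !normrM ler_wpM2r//.
    by rewrite (le_trans (VK t))// ler_norm.
  - exact: integrableZl.
have K0 : 0 <= K := le_trans (normr_ge0 _) (VK 0).
have fN := integrable_fin_num measurableT if2.
have fB := integrable_fin_num measurableT ig2.
have fA := integrable_fin_num measurableT iVf.
set N := fine (\int[lam]_t (f t ^+ 2)%:E)%E.
set B := fine (\int[lam]_t (g t ^+ 2)%:E)%E.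
set A := fine (\int[lam]_t (V t * f t ^+ 2)%:E)%E.
have EN : (\int[lam]_t (f t ^+ 2)%:E = N%:E)%E by rewrite fineK.
have EB : (\int[lam]_t (g t ^+ 2)%:E = B%:E)%E by rewrite fineK.
have EA : (\int[lam]_t (V t * f t ^+ 2)%:E = A%:E)%E by rewrite fineK.
have N0 : 0 <= N by rewrite -lee_fin -EN integral_ge0// => t _; rewrite lee_fin sqr_ge0.
have B0 : 0 <= B by rewrite -lee_fin -EB integral_ge0// => t _; rewrite lee_fin sqr_ge0.
have EVK : (\int[lam]_t ((V t + K) * f t ^+ 2)%:E = (A + K * N)%:E)%E.
  rewrite (eq_integral (fun t : measurableTypeR R =>
    (V t * f t ^+ 2)%:E + K%:E * (f t ^+ 2)%:E)%E).
    rewrite integralD//; last exact: integrableZl.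
    by rewrite integralZl// EA EN -EFinM -EFinD.
  by move=> t _; rewrite mulrDl EFinD EFinM.
rewrite EVK EB EN -!EFinM -EFinD lee_fin.
suff : A <= 4 * c * B + c * L * N by lra.
(* A null [f] cannot be normalized; in that case 0 <= V + K <= 2 K forces the left-hand integral to
   be at most 0. *)
have [N00|Nn0] := eqVneq N 0.
  have : (\int[lam]_t ((V t + K) * f t ^+ 2)%:E <=
      \int[lam]_t ((2 * K)%:E * (f t ^+ 2)%:E))%E.
    apply: ge0_le_integral => //.
    - move=> t _; rewrite lee_fin mulr_ge0 ?sqr_ge0//.
      by have := VK t; rewrite ler_norml => /andP[]; lra.
    - by apply/measurable_EFinP; apply: measurable_funM => //; exact: measurable_funD.
    - by apply/measurable_EFinP; exact: measurable_funM.
    - move=> t _; rewrite lee_fin ler_wpM2r ?sqr_ge0//.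
      by have := VK t; rewrite ler_norml => /andP[]; lra.
  rewrite integralZl// EVK EN N00 mulr0 addr0 mule0 lee_fin => A0.
  by rewrite mulr0 addr0 (le_trans A0)// !mulr_ge0// ltW.
have Ngt0 : 0 < N by rewrite lt_neqAle eq_sym Nn0.
(* [s * f] has unit norm, hence competes in the supremum defining [lambda]; multiplying the
   resulting inequality by [c * N] undoes the scaling and the division of [V] by [c]. *)
pose s := (Num.sqrt N)^-1.
have s2 : s ^+ 2 = N^-1 by rewrite /s exprVn sqr_sqrtr.
have H1 : H1_grad (fun x : 'rV[R]_1 => s * f (x ord0 ord0))
    (fun x : 'rV[R]_1 => const_mx (s * g (x ord0 ord0))).
  apply: (H1_grad_line (f := fun t => s * f t) (g := fun t => s * g t)).
  - exact: square_integrable_scale.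
  - exact: square_integrable_scale.
  - move=> b b' Cb; have [sb sb'] := C1_test_square_integrable Cb.
    under eq_integral => t _ do rewrite -mulrA EFinM.
    under [in RHS]eq_integral => t _ do rewrite -mulrA EFinM.
    rewrite !integralZl//; [|exact: square_integrable_mul..].
    by rewrite (fg _ _ Cb) muleN.
have : (((s ^+ 2 * (c^-1 * A)) - 4 * (s ^+ 2 * B))%:E <= L%:E)%E.
  apply: le_trans lamL; apply: ereal_sup_ubound.
  exists (fun x : 'rV[R]_1 => s * f (x ord0 ord0)).
  exists (fun x : 'rV[R]_1 => const_mx (s * g (x ord0 ord0))); split => //.
  - rewrite (integral_head_rV1 (F := fun t => (s * f t) ^+ 2)); last first.
      by apply: measurable_funX; exact: measurable_funM.
    under eq_integral => t _ do rewrite exprMn EFinM.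
    by rewrite integralZl// EN s2 -EFinM mulVf.
  - rewrite (integral_head_rV1 (F := fun t => c^-1 * V t * (s * f t) ^+ 2)); last first.
      by apply: measurable_funM; [exact: measurable_funM|
         apply: measurable_funX; exact: measurable_funM].
    rewrite (eq_integral (fun t : measurableTypeR R =>
      (s ^+ 2 * c^-1)%:E * (V t * f t ^+ 2)%:E)%E); last first.
      by move=> t _; rewrite -EFinM; congr EFin; rewrite exprMn; ring.
    rewrite integralZl// EA.
    under [X in (_ - _ * X)%E]eq_integral => x _ do rewrite /dotp big_ord1 !mxE -expr2.
    rewrite (integral_head_rV1 (F := fun t => (s * g t) ^+ 2)); last first.
      by apply: measurable_funX; exact: measurable_funM.
    under [X in (_ - _ * X)%E]eq_integral => t _ do rewrite exprMn EFinM.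
    by rewrite integralZl// EB -!EFinM -EFinB; congr EFin; ring.
rewrite lee_fin s2 => H.
have := ler_wpM2r (ltW (mulr_gt0 c0 Ngt0)) H.
rewrite (_ : (_ - _) * (c * N) = A - 4 * c * B).
  by move=> H'; rewrite -subr_ge0; rewrite -subr_ge0 in H'; lra.
by field; rewrite !gt_eqF.
Qed.

End line_as_rV1.

(** * Slicing *)

Section slicing.
Variables (R : realType) (n : nat) (u : 'rV[R]_n).
Let mu := lebesgue_rV R n.
Local Notation lam := (@lebesgue_measure R).
Hypothesis u_unit : dotp u u = 1.
Implicit Types (F : 'rV[R]_n -> \bar R) (x : 'rV[R]_n).

Let I01 : set (measurableTypeR R) := `[0, 1]%classic.

(** As [u] is a unit vector, every line of direction [u] meets the slab in a segment of length 1. *)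
Definition slab x : R := \1_I01 (dotp u x).

Lemma slab_ge0 x : 0 <= slab x.
Proof. by rewrite /slab indicE. Qed.

Lemma dotp_shift x (t : R) : dotp u (x + t *: u) = dotp u x + t.
Proof.
rewrite -[X in _ = _ + X]mulr1 -u_unit /dotp big_distrr/= -big_split/=.
by apply: eq_bigr => i _; rewrite !mxE mulrDr mulrCA.
Qed.

Lemma measurable_dotp : measurable_fun setT (fun x => (dotp u x : measurableTypeR R)).
Proof.
rewrite /dotp; apply: measurable_sum => i.
by apply: measurable_funM => //; exact: measurable_rV_coord.
Qed.

Lemma measurable_slab : measurable_fun setT slab.
Proof.
apply: (measurableT_comp _ measurable_dotp).
by apply: measurable_indic; exact: measurable_itv.
Qed.

(** The point of the line through [x] of direction [u] at height [t]. All base points on one line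
    yield the same parametrization, and [V (dotp u _)] becomes [V t] along it. *)
Definition slice_point (x : 'rV[R]_n) (t : R) : 'rV[R]_n := x + (t - dotp u x) *: u.

Lemma dotp_slice_point x t : dotp u (slice_point x t) = t.
Proof. by rewrite /slice_point dotp_shift addrC subrK. Qed.

Lemma measurable_slice_point : measurable_fun setT
  (fun z : 'rV[R]_n * measurableTypeR R => slice_point z.1 z.2).
Proof.
have mp : measurable_fun setT (fun z : 'rV[R]_n * measurableTypeR R =>
    (z.1, (z.2 - dotp u z.1 : measurableTypeR R))).
  apply: measurable_fun_pair => //; apply: measurable_funB => //.
  exact: measurableT_comp measurable_dotp measurable_fst.
exact: measurableT_comp (@measurable_line R n u) mp.
Qed.

Lemma integral_line_shift (h : measurableTypeR R -> \bar R) (s : R) :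
  measurable_fun setT h -> (\int[lam]_t h (t + s)%R = \int[lam]_t h t)%E.
Proof.
apply: integral_preserving; first exact: measurable_funD.
by move=> A mA; exact: lebesgue_measure_shift.
Qed.

(* Averaging over the slab [0 <= u.x <= 1] replaces the change of variables
   to an orthonormal basis containing [u]. *)
Lemma slicing F : measurable_fun setT F -> (forall x, 0 <= F x)%E ->
  (\int[mu]_x F x =
   \int[mu]_x ((slab x)%:E * \int[lam]_t F (slice_point x t)))%E.
Proof.
move=> mF F0.
have mFl : measurable_fun setT (fun z : 'rV[R]_n * measurableTypeR R =>
    F (z.1 + (z.2 : R) *: u)).
  exact: measurableT_comp mF (@measurable_line R n u).
have mH : measurable_fun setT (fun z : 'rV[R]_n * measurableTypeR R =>
    ((slab z.1)%:E * F (z.1 + (z.2 : R) *: u)%R)%E).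
  apply: emeasurable_funM => //; apply/measurable_EFinP.
  exact: measurableT_comp measurable_slab measurable_fst.
have H0 z : (0 <= (slab z.1)%:E * F (z.1 + (z.2 : R) *: u)%R)%E.
  by rewrite mule_ge0// lee_fin slab_ge0.
pose sl (z : 'rV[R]_n * measurableTypeR R) : R := slab (z.1 + (z.2 : R) *: - u).
have msl : measurable_fun setT sl.
  exact: measurableT_comp measurable_slab (@measurable_line R n (- u)).
have mslE : measurable_fun setT (fun z => (sl z)%:E) by exact/measurable_EFinP.
(* In [t], [sl (x, t)] is the indicator of the interval from u.x - 1 to u.x, of integral 1, so it
   can be inserted. After exchanging the integrals, the translation by [t u] puts the slab on [x]
   and the parameter [t] into [F]. *)
transitivity (\int[mu]_x \int[lam]_t ((sl (x, t))%:E * F x))%E; last first.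
  rewrite (fubini_tonelli (fun z => ((sl z)%:E * F z.1)%E)); last 2 first.
  - apply: emeasurable_funM; first exact/measurable_EFinP.
    exact: measurableT_comp mF measurable_fst.
  - by move=> z; rewrite mule_ge0// lee_fin slab_ge0.
  transitivity (\int[lam]_t \int[mu]_x ((slab x)%:E * F (x + t *: u)%R))%E.
    apply: eq_integral => t _.
    rewrite -(integral_shift_rV (t *: u)).
      by apply: eq_integral => x _; rewrite /sl/= scalerN addrK.
    apply: emeasurable_funM => //; apply/measurable_EFinP.
    exact: (measurable_fun_pair1 t msl).
  rewrite -(fubini_tonelli _ mH H0).
  apply: eq_integral => x _ /=; rewrite ge0_integralZl//; last 2 first.
  - exact: (measurable_fun_pair2 x mFl).
  - by rewrite lee_fin slab_ge0.
  congr (_ * _)%E.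
  rewrite -[LHS](integral_line_shift (- dotp u x))//.
  exact: (measurable_fun_pair2 x mFl).
apply: eq_integral => x _; rewrite ge0_integralZr//; last 2 first.
- exact: (measurable_fun_pair2 x mslE).
- by move=> t _; rewrite lee_fin slab_ge0.
rewrite (eq_integral (fun t : measurableTypeR R =>
  (\1_(`[dotp u x - 1, dotp u x]%classic : set (measurableTypeR R)) t : R)%:E)).
  rewrite integral_indic//.
  rewrite setIT [X in (X * _)%E](_ : _ = 1%E) ?mul1e//.
  apply: etrans (lebesgue_measure_itv _) _.
  by rewrite /= lte_fin gtrBl ltr01 -EFinB opprB addrC subrK.
move=> t _; congr EFin; rewrite /sl /slab/= scalerN -scaleNr dotp_shift.
rewrite !indicE !mem_setE !in_itv/= subr_ge0 lerBlDr lerBlDl andbC.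
by rewrite (addrC 1).
Qed.

Lemma measurable_slice_integral F : measurable_fun setT F ->
  measurable_fun setT
    (fun x => (slab x)%:E * \int[lam]_t F (slice_point x t))%E.
Proof.
move=> mF; apply: emeasurable_funM.
  by apply/measurable_EFinP; exact: measurable_slab.
have mFs : measurable_fun setT (fun z : 'rV[R]_n * measurableTypeR R =>
    F (slice_point z.1 z.2)).
  exact: measurableT_comp mF measurable_slice_point.
exact: (measurable_section_integral lam mFs).
Qed.

(** By [slicing], the slice integrals of f^2 weighted by the slab have a finite total, so almost all
    of them are finite where the weight is 1. *)
Lemma ae_square_integrable_slice (f : 'rV[R]_n -> R) :
  square_integrable mu f -> {ae mu, forall x, slab x = 1 ->
    square_integrable lam (fun t => f (slice_point x t))}.
Proof.
move=> [mf lf].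
have mf2 : measurable_fun setT (fun x => (f x ^+ 2)%:E).
  by apply/measurable_EFinP; exact: measurable_funX.
have f20 x : (0 <= (f x ^+ 2)%:E)%E by rewrite lee_fin sqr_ge0.
have : mu.-integrable setT
    (fun x => (slab x)%:E * \int[lam]_t (f (slice_point x t) ^+ 2)%:E)%E.
  apply/integrableP; split.
    exact: (measurable_slice_integral mf2).
  apply: le_lt_trans lf; rewrite (slicing mf2 f20).
  rewrite le_eqVlt; apply/orP; left; apply/eqP; apply: eq_integral => x _.
  by rewrite gee0_abs// mule_ge0 ?lee_fin ?slab_ge0 ?integral_ge0.
move/(integrable_ae measurableT); apply: filterS => x /= /(_ I) + sx1.
rewrite sx1 mul1e => fin; split.
  have := measurableT_comp mf measurable_slice_point.
  by move/(measurable_fun_pair2 x).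
by rewrite -ge0_fin_numE// integral_ge0.
Qed.

Variables (phi g : 'rV[R]_n -> R).
Hypothesis sphi : square_integrable mu phi.
Hypothesis sg : square_integrable mu g.
Hypothesis weak : forall psi, flat_test psi ->
  (\int[mu]_x (phi x * 'D_u psi x)%:E = - \int[mu]_x (g x * psi x)%:E)%E.

(** The quantifier over [b] stands inside the almost-everywhere one: the exceptional set comes from
    square integrability and the increment formula, neither of which mentions a test function. *)
Lemma ae_slice_weak : {ae mu, forall x, slab x = 1 -> forall b b', C1_test b b' ->
  (\int[lam]_t (phi (slice_point x t) * b' t)%:E =
   - \int[lam]_t (g (slice_point x t) * b t)%:E)%E}.
Proof.
have A1 := ae_square_integrable_slice sphi.
have A2 := ae_square_integrable_slice sg.
have A3 := absolutely_continuous_on_lines sphi sg weak.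
apply: filterS (filterI (filterI A1 A2) A3) => x [[s1 s2] ac] sx b b' Cb.
have {s1}[mp ip] := s1 sx; have {s2}[mq iq] := s2 sx.
set s := dotp u x.
have sq (h : 'rV[R]_n -> R) : measurable_fun setT h ->
    (\int[lam]_t (h (slice_point x t) ^+ 2)%:E < +oo)%E ->
    square_integrable lam (fun t => h (x + t *: u)).
  move=> mh hoo.
  have ml : measurable_fun [set: measurableTypeR R] (fun t => h (x + t *: u)).
    have := measurableT_comp mh (@measurable_line R n u).
    by move/(measurable_fun_pair2 x).
  split => //; rewrite -(integral_line_shift (- s))//.
  by apply/measurable_EFinP; exact: measurable_funX.
have sp : square_integrable lam (fun t => phi (x + t *: u)).
  by apply: sq => //; case: sphi.
have sq' : square_integrable lam (fun t => g (x + t *: u)).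
  by apply: sq => //; case: sg.
(* The increment formula is parametrized by [x + r u], the slice by the height t = r + s; the test
   function is shifted accordingly. *)
have Cs := C1_test_shift s Cb.
have [sb sb'] := C1_test_square_integrable Cs.
have [mb _] := sb; have [mb' _] := sb'.
have := weak_derivative_of_primitive sp sq'
  (fun k => ex_intro _ (phi (x + (- k%:R) *: u)) (ac k)) Cs.
have [msp _] := sp; have [msq _] := sq'.
rewrite -(integral_line_shift (- s)); last first.
  by apply/measurable_EFinP; exact: measurable_funM.
rewrite -[X in _ = (- X)%E -> _](integral_line_shift (- s)); last first.
  by apply/measurable_EFinP; exact: measurable_funM.
under eq_integral => t _ do rewrite subrK.
by under [in RHS]eq_integral => t _ do rewrite subrK.
Qed.

(** All three integrals are written by [slicing]. On almost every slice inside the slab the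
    integrands compare by [line_bound]; outside, both are 0. *)
Lemma direction_bound (V : R -> R) (c L K : R) :
  continuous V -> (forall t, `|V t| <= K) -> 0 < c -> 0 <= c * L + K ->
  (lambda (fun y : 'rV[R]_1 => (c^-1 * V (y ord0 ord0))%R) <= L%:E)%E ->
  (\int[mu]_x ((V (dotp u x) + K) * phi x ^+ 2)%:E <=
   (4 * c)%:E * \int[mu]_x (g x ^+ 2)%:E
   + (c * L + K)%:E * \int[mu]_x (phi x ^+ 2)%:E)%E.
Proof.
move=> cV VK c0 cLK lamL.
have [mphi _] := sphi; have [mg _] := sg.
have mV : measurable_fun setT (fun x => V (dotp u x)).
  exact: measurableT_comp (continuous_measurable_R cV) measurable_dotp.
have m1 : measurable_fun setT (fun x => ((V (dotp u x) + K) * phi x ^+ 2)%:E).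
  apply/measurable_EFinP; apply: measurable_funM; first exact: measurable_funD.
  exact: measurable_funX.
have m2 : measurable_fun setT (fun x => (g x ^+ 2)%:E).
  by apply/measurable_EFinP; exact: measurable_funX.
have m3 : measurable_fun setT (fun x => (phi x ^+ 2)%:E).
  by apply/measurable_EFinP; exact: measurable_funX.
have p1 x : (0 <= ((V (dotp u x) + K) * phi x ^+ 2)%:E)%E.
  rewrite lee_fin mulr_ge0 ?sqr_ge0//.
  by have := VK (dotp u x); rewrite ler_norml => /andP[]; lra.
have p2 x : (0 <= (g x ^+ 2)%:E)%E by rewrite lee_fin sqr_ge0.
have p3 x : (0 <= (phi x ^+ 2)%:E)%E by rewrite lee_fin sqr_ge0.
have c40 : 0 <= 4 * c by rewrite mulr_ge0// ltW.
rewrite (slicing m1 p1) (slicing m2 p2) (slicing m3 p3).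
have q F x : (forall x, 0 <= F x)%E ->
    (0 <= (slab x)%:E * \int[lam]_t F (slice_point x t))%E.
  by move=> F0; rewrite mule_ge0 ?lee_fin ?slab_ge0 ?integral_ge0.
have r1 := measurable_slice_integral m1.
have r2 := measurable_slice_integral m2.
have r3 := measurable_slice_integral m3.
rewrite -ge0_integralZl//; [|by move=> x _; exact: (q _ x p2)].
rewrite -ge0_integralZl//; [|by move=> x _; exact: (q _ x p3)].
rewrite -ge0_integralD//; last 4 first.
- by move=> x _; rewrite mule_ge0//; exact: (q _ x p2).
- by apply: emeasurable_funM.
- by move=> x _; rewrite mule_ge0//; exact: (q _ x p3).
- by apply: emeasurable_funM.
apply: ae_ge0_le_integral => //.
- by move=> x _; exact: (q _ x p1).
- by move=> x _; rewrite adde_ge0// mule_ge0//; [exact: (q _ x p2)|exact: (q _ x p3)].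
- by apply: emeasurable_funD; apply: emeasurable_funM.
have A1 := ae_square_integrable_slice sphi.
have A2 := ae_square_integrable_slice sg.
apply: filterS (filterI (filterI A1 A2) ae_slice_weak) => x [[s1 s2] w] _.
have [sx|sx] : slab x = 1 \/ slab x = 0.
  by rewrite /slab indicE; case: (_ \in _); [left|right].
- rewrite sx !mul1e.
  have H := line_bound cV VK c0 cLK lamL (s1 sx) (s2 sx) (w sx).
  by under [X in (X <= _)%E]eq_integral => t _ do rewrite dotp_slice_point.
- by rewrite sx !mul0e !mule0 adde0.
Qed.

End slicing.

(** * From one direction to the sum over all directions *)

Lemma integral_sum_scale d (T : measurableType d) (R : realType)
    (mu : {measure set T -> \bar R}) (I : Type) (s : seq I) (a : I -> R)
    (f : I -> T -> R) :
  (forall i, mu.-integrable setT (EFin \o f i)) ->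
  mu.-integrable setT (EFin \o (fun x => \sum_(i <- s) a i * f i x)) /\
  (\int[mu]_x (\sum_(i <- s) a i * f i x)%:E =
   \sum_(i <- s) (a i)%:E * \int[mu]_x (f i x)%:E)%E.
Proof.
move=> fi; elim: s => [|i s [IHi IHe]].
  rewrite big_nil; under eq_integral do rewrite big_nil.
  rewrite integral0; split => //.
  rewrite (_ : _ \o _ = cst 0%E); first exact: integrable0.
  by apply/funext => x /=; rewrite big_nil.
have E : (EFin \o (fun x => \sum_(j <- i :: s) a j * f j x)) =
    ((fun x => (a i)%:E * (f i x)%:E) \+
     (EFin \o (fun x => (\sum_(j <- s) a j * f j x)%R)))%E.
  by apply/funext => x /=; rewrite big_cons EFinD EFinM.
have ai : mu.-integrable setT (fun x => (a i)%:E * (f i x)%:E)%E.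
  by apply: integrableZl => //; exact: fi.
split; first by rewrite E; exact: integrableD.
rewrite big_cons -IHe -integralZl//; last exact: fi.
by rewrite -integralD//; apply: eq_integral => x _; exact: (congr1 (@^~ x) E).
Qed.

Section H1_direction.
Variables (R : realType) (n : nat) (u : 'rV[R]_n).
Variables (phi : 'rV[R]_n -> R) (G : 'rV[R]_n -> 'rV[R]_n).
Let mu := lebesgue_rV R n.
Hypothesis phiG : H1_grad phi G.

Lemma H1_square_integrable : square_integrable mu phi.
Proof. by have [/Lfun2_square_integrable] := phiG. Qed.

Lemma H1_grad_square_integrable i : square_integrable mu (fun x => G x ord0 i).
Proof. by have [_ /(_ i)[/Lfun2_square_integrable]] := phiG. Qed.

Lemma H1_direction_square_integrable :
  square_integrable mu (fun x => dotp u (G x)).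
Proof.
apply: square_integrable_sum => i; apply: square_integrable_scale.
exact: H1_grad_square_integrable.
Qed.

(** The weak partial derivatives are combined with the coordinates of [u] as coefficients;
    finiteness of each integral lets the minus sign pass through the sum of extended reals. *)
Lemma H1_direction_weak psi : flat_test psi ->
  (\int[mu]_x (phi x * 'D_u psi x)%:E = - \int[mu]_x (dotp u (G x) * psi x)%:E)%E.
Proof.
move=> tpsi; have [D [tD pD dD]] := flat_test_derive tpsi.
have sp := H1_square_integrable; have spsi := flat_test_square_integrable tpsi.
transitivity (\int[mu]_x (\sum_(i < n) u ord0 i * (phi x * D i x))%:E)%E.
  apply: eq_integral => x _; rewrite (@derive_val _ _ _ _ _ _ _ (dD x u)).
  by congr EFin; rewrite big_distrr/=; apply: eq_bigr => i _; rewrite mulrCA.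
rewrite (integral_sum_scale (f := fun i x => phi x * D i x) _ _ _).2; last first.
  by move=> i; apply: square_integrable_mul => //; exact: flat_test_square_integrable.
have E : (\int[mu]_x (dotp u (G x) * psi x)%:E =
    \sum_(i < n) (u ord0 i)%:E * \int[mu]_x (G x ord0 i * psi x)%:E)%E.
  rewrite -(integral_sum_scale (f := fun i x => G x ord0 i * psi x) _ _ _).2.
    apply: eq_integral => x _; congr EFin; rewrite /dotp big_distrl/=.
    by apply: eq_bigr => i _; rewrite mulrA.
  move=> i; apply: square_integrable_mul => //; exact: H1_grad_square_integrable.
rewrite E -sumeN.
  apply: eq_bigr => i _; rewrite -muleN.
  have [_ /(_ i)[_ /(_ psi (flat_test_function tpsi))]] := phiG.
  by rewrite pD => ->.
move=> i j _ _; apply: fin_num_adde_defl; rewrite fin_numM//.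
apply: integrable_fin_num => //; apply: square_integrable_mul => //.
exact: H1_grad_square_integrable.
Qed.

End H1_direction.

(** [direction_bound] for a large [K], whose contributions to the two sides are equal since phi has
    unit norm. It holds for every real bound [L] of [lambda], which also settles the infinite values
    of [lambda]. *)
Lemma direction_energy_le (R : realType) (n : nat) (u : 'rV[R]_n) (c : R)
    (V : R -> R) (phi : 'rV[R]_n -> R) (G : 'rV[R]_n -> 'rV[R]_n) :
  dotp u u = 1 -> 0 < c -> continuous V -> bounded_fun V -> H1_grad phi G ->
  (\int[lebesgue_rV R n]_x (phi x ^+ 2)%:E = 1)%E ->
  (lebesgue_rV R n).-integrable setT (fun x => (V (dotp u x) * phi x ^+ 2)%:E) /\
  (\int[lebesgue_rV R n]_x (V (dotp u x) * phi x ^+ 2)%:E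
   - (4 * c)%:E * \int[lebesgue_rV R n]_x (dotp u (G x) ^+ 2)%:E
   <= c%:E * lambda (fun y : 'rV[R]_1 => (c^-1 * V (y ord0 ord0))%R))%E.
Proof.
set mu := lebesgue_rV R n; move=> uu c0 cV [M [_ HM]] phiG phi1.
have VM t : `|V t| <= `|M| + 1 by apply: HM => //; rewrite ltr_pwDr// ler_norm.
have sphi := H1_square_integrable phiG; have [mphi _] := sphi.
have sg := H1_direction_square_integrable u phiG.
have mV : measurable_fun setT (fun x : 'rV[R]_n => V (dotp u x)).
  exact: measurableT_comp (continuous_measurable_R cV) (measurable_dotp u).
have iphi := square_integrable_sqr sphi; have ig := square_integrable_sqr sg.
have iV : mu.-integrable setT (fun x => (V (dotp u x) * phi x ^+ 2)%:E).
  apply: (@le_integrable _ _ _ mu _ measurableT _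
    (fun x => (`|M| + 1)%:E * (phi x ^+ 2)%:E)%E).
  - apply/measurable_EFinP; apply: measurable_funM => //.
    exact: measurable_funX.
  - move=> x _; rewrite /= lee_fin !normrM ler_wpM2r//.
    by rewrite (le_trans (VM _))// ler_norm.
  - exact: integrableZl.
split => //.
have fA := integrable_fin_num measurableT iV.
have fB := integrable_fin_num measurableT ig.
set A := fine (\int[mu]_x (V (dotp u x) * phi x ^+ 2)%:E)%E.
set B := fine (\int[mu]_x (dotp u (G x) ^+ 2)%:E)%E.
have EA : (\int[mu]_x (V (dotp u x) * phi x ^+ 2)%:E = A%:E)%E by rewrite fineK.
have EB : (\int[mu]_x (dotp u (G x) ^+ 2)%:E = B%:E)%E by rewrite fineK.
rewrite EA EB -EFinM -EFinB.
have key L : (lambda (fun y : 'rV[R]_1 => (c^-1 * V (y ord0 ord0))%R) <= L%:E)%E ->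
    A - 4 * c * B <= c * L.
  (* The first two terms dominate [|V|], the last one makes [c * L + K] nonnegative. *)
  move=> lamL; pose K := `|M| + 1 + `|c * L|.
  have VK t : `|V t| <= K by rewrite (le_trans (VM t))// lerDl.
  have cLK : 0 <= c * L + K.
    rewrite /K addrCA addr_ge0// -[`|c * L|]normrN.
    by rewrite -lerBlDl sub0r ler_norm.
  have := direction_bound uu sphi sg (H1_direction_weak u phiG) cV VK c0 cLK lamL.
  rewrite phi1 EB mule1 -EFinM -EFinD.
  rewrite (eq_integral (fun x => (V (dotp u x) * phi x ^+ 2)%:E
     + K%:E * (phi x ^+ 2)%:E)%E); last first.
    by move=> x _; rewrite mulrDl EFinD EFinM.
  rewrite integralD//; last exact: integrableZl.
  rewrite integralZl// phi1 EA mule1 -EFinD lee_fin; lra.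
move: key; case: (lambda _) => [r| |] key.
- by rewrite -EFinM lee_fin; exact: key.
- by rewrite gt0_muley ?lte_fin// leey.
(* If [lambda] were -oo, every real [L] would be a bound; this one contradicts [key]. *)
- exfalso; have := key ((A - 4 * c * B) / c - 1); rewrite leNye => /(_ isT).
  rewrite mulrBr mulr1 mulrCA divff ?gt_eqF// mulr1; lra.
Qed.

Theorem theorem5p1 (R : realType) (n m : nat) (u : 'I_m -> 'rV[R]_n)
    (c : 'I_m -> R) (V : 'I_m -> R -> R)
    (u_unit : forall j, dotp (u j) (u j) = 1)
    (c_gt0 : forall j, 0 < c j)
    (decomp : forall x : 'rV[R]_n, \sum_(j < m) c j *: tensor (u j) x = x)
    (V_cont : forall j, continuous (V j))
    (V_bnd : forall j, bounded_fun (V j)) :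
  (lambda (fun x : 'rV[R]_n => (\sum_(j < m) V j (dotp (u j) x))%R)
   <= \sum_(j < m) (c j)%:E *
        lambda (fun y : 'rV[R]_1 => ((c j)^-1 * V j (y ord0 ord0))%R))%E.
Proof.
apply: ge_ereal_sup => _ [phi [G [phiG phi1 ->]]].
pose mu := lebesgue_rV R n.
have B j := direction_energy_le (u_unit j) (c_gt0 j) (V_cont j) (V_bnd j) phiG phi1.
have ig j := square_integrable_sqr (H1_direction_square_integrable (u j) phiG).
have -> : (\int[mu]_x (dotp (G x) (G x))%:E =
    \sum_(j < m) (c j)%:E * \int[mu]_x (dotp (u j) (G x) ^+ 2)%:E)%E.
  rewrite -(integral_sum_scale (f := fun j x => dotp (u j) (G x) ^+ 2) _ _ _).2//.
  (* Only the first factor is decomposed; pairing it with the second gives c_j (u_j . G x)^2 for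
     each j. *)
  apply: eq_integral => x _; congr EFin; rewrite -{1}(decomp (G x)).
  rewrite /dotp (eq_bigr (fun i => \sum_(j < m)
    c j * (dotp (u j) (G x) * u j ord0 i * G x ord0 i))); last first.
    move=> i _; rewrite summxE big_distrl/=; apply: eq_bigr => j _.
    by rewrite /tensor !mxE !mulrA.
  rewrite exchange_big/=; apply: eq_bigr => j _.
  rewrite -big_distrr/=; congr (_ * _); rewrite expr2 /dotp big_distrr/=.
  by apply: eq_bigr => i _; rewrite mulrA.
have -> : (\int[mu]_x ((\sum_(j < m) V j (dotp (u j) x)) * phi x ^+ 2)%:E =
    \sum_(j < m) \int[mu]_x (V j (dotp (u j) x) * phi x ^+ 2)%:E)%E.
  under eq_integral => x _ do rewrite big_distrl/= -(eq_bigr _ (fun j _ => mul1r _)).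
  rewrite (integral_sum_scale (f := fun j x => V j (dotp (u j) x) * phi x ^+ 2) _ _ _).2.
    by apply: eq_bigr => j _; rewrite mul1e.
  by move=> j; exact: (B j).1.
rewrite ge0_sume_distrr; last first.
  move=> j _; apply: mule_ge0; first by rewrite lee_fin ltW.
  by apply: integral_ge0 => x _; rewrite lee_fin sqr_ge0.
(* Negation commutes with this sum of extended reals because every directional energy is finite. *)
rewrite -sumeN; last first.
  move=> i j _ _; apply: fin_num_adde_defl; rewrite !fin_numM//.
  exact: integrable_fin_num (ig j).
rewrite -big_split/=; apply: lee_sum => j _.
by have := (B j).2; rewrite EFinM -muleA.
Qed.
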